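(* Let $(\rho,\mu_\rho,\theta,\eta,\mu_\eta,\lambda)$ be a global generalised dissipative weak solution. Then, with $Z=(\nabla\mu_\rho,-\nabla\theta,\mu_\eta)$, $$\int_0^\infty\!\!\int_\Omega Z^\top\mathbf L(z,\theta)Z\,dx\,dt<\infty,$$ and, for almost every $t>0$, with a constant $C$ independent of $t$, $$\|z(t)\|_{H^1}^2+\|z(t)\|_{L^4}^4+\|\theta(t)\|_{L^1}+\|\theta(t)^{-q}\|_{L^1}+\|\lambda_t\|_{\mathcal M(\overline\Omega)}\le C.$$ In particular, $$\int_0^\infty\bigl(\|\nabla\mu_\rho\|_{L^2}^2+\|\nabla\theta\|_{L^2}^2+\|\mu_\eta\|_{L^2}^2\bigr)\,dt<\infty.$$
   Context: $\Omega=\mathbb T^d$, $1\le d\le3$, is the flat torus, $z=(\rho,\eta)\in\mathbb R^2$, $(\cdot,\cdot)$ is the $L^2(\Omega)$ inner product, $\langle\cdot,\cdot\rangle$ the duality pairing in space. Potential: fix $q>1$ with $q\ge d$, constants $\varepsilon_1,\varepsilon_q,\gamma_\rho,\gamma_\eta>0$, and non-negative polynomials $F_0,F_1$ on $\mathbb R^2$ of degree at most four with $|DF_j(z)|\le C(1+|z|^3)$, $|D^2F_j(z)|\le C(1+|z|^2)$, such that for some $a>0$, $c_a,C_a>0$: $aF_1(z)-F_0(z)\ge c_a|z|^4-C_a$. For $\theta>0$, $$\psi(z,\theta)=\ln\theta-\varepsilon_1\theta(\ln\theta-1)-\tfrac{\varepsilon_q}{q-1}\theta^{1-q}-F_0(z)+\theta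 F_1(z),\quad e=\partial_\theta\psi,\quad s_{\rm bulk}=\theta e-\psi,$$ $$\mathscr S(z,\theta)=\int_\Omega s_{\rm bulk}(z,\theta)\,dx-\tfrac{\gamma_\rho}2\|\nabla\rho\|_{L^2}^2-\tfrac{\gamma_\eta}2\|\nabla\eta\|_{L^2}^2 .$$ Mobility: $\mathbf L(z,\theta)\in\mathbb R^{(2d+1)\times(2d+1)}$ is continuous, bounded, symmetric, $\lambda_0|\zeta|^2\le\zeta^\top\mathbf L\zeta\le\lambda_1|\zeta|^2$ with $0<\lambda_0\le\lambda_1$, with blocks $\mathbf L_{11},\mathbf L_{12},\mathbf L_{22}\in\mathbb R^{d\times d}$, $\mathbf L_{13},\mathbf L_{23}\in\mathbb R^d$, $\mathbf L_{33}\in\mathbb R$ (rows $(\mathbf L_{11},\mathbf L_{12},\mathbf L_{13})$, $(\mathbf L_{12}^\top,\mathbf L_{22},\mathbf L_{23})$, $(\mathbf L_{13}^\top,\mathbf L_{23}^\top,\mathbf L_{33})$). $\mathcal M(\overline\Omega)=C(\overline\Omega)^*$ (finite signed Radon measures), $\mathcal M_+$ its non-negative elements, $L^\infty_{\rm w*}(0,T;\mathcal M(\overline\Omega))$ the weak-star measurable essentially bounded measure-valued maps. Generalised dissipative weak solution on $(0,T)$ with initial data $(\rho_0,\theta_0,\eta_0)$, $z_0=(\rho_0,\eta_0)$ (for which all quantities below are defined and finite): a sextuple with $\rho,\eta\in L^\infty(0,T;H^1)$, $\mu_\rho\in L^2(0,T;H^1)$, $\theta\in L^2(0,T;H^1)\cap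 L^\infty(0,T;L^1)$, $\theta^{-q}\in L^\infty(0,T;L^1)$, $\mu_\eta\in L^2((0,T)\times\Omega)$, $\theta>0$ a.e., $\lambda\in L^\infty_{\rm w*}(0,T;\mathcal M_+(\overline\Omega))$, such that, with $\mathcal J_\rho=\mathbf L_{11}\nabla\mu_\rho-\mathbf L_{12}\nabla\theta+\mathbf L_{13}\mu_\eta$, $\mathcal J_e=\mathbf L_{12}^\top\nabla\mu_\rho-\mathbf L_{22}\nabla\theta+\mathbf L_{23}\mu_\eta$, $\mathcal R_\eta=\mathbf L_{13}\cdot\nabla\mu_\rho-\mathbf L_{23}\cdot\nabla\theta+\mathbf L_{33}\mu_\eta$ (mobility at $(z,\theta)$), $\mathfrak E_t=e(z(t),\theta(t))dx+\lambda_t$, for all $v,\xi,w\in C^1([0,T];C^\infty_{\rm per}(\Omega))$ vanishing at $t=T$ and all $\varphi,\chi\in C^\infty_c((0,T);C^\infty_{\rm per}(\Omega))$: $-\int_0^T(\rho,\partial_tv)dt-(\rho_0,v(0))+\int_0^T(\mathcal J_\rho,\nabla v)dt=0$; $-\int_0^T(e(z,\theta),\partial_t\xi)dt-\int_0^T\langle\lambda_t,\partial_t\xi(t)\rangle dt-(e(z_0,\theta_0),\xi(0))+\int_0^T(\mathcal J_e,\nabla\xi)dt=0$; $-\int_0^T(\eta,\partial_tw)dt-(\eta_0,w(0))+\int_0^T(\mathcal R_\eta,w)dt=0$; $\int_0^T(\mu_\rho,\varphi)dt=\gamma_\rho\int_0^T(\nabla\rho,\nabla\varphi)dt+\int_0^T(\partial_\rho\psi(z,\theta),\varphi)dt$;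 $\int_0^T(\mu_\eta,\chi)dt=\gamma_\eta\int_0^T(\nabla\eta,\nabla\chi)dt+\int_0^T(\partial_\eta\psi(z,\theta),\chi)dt$; and for a.e. $t$, $\mathscr S(z(t),\theta(t))\ge\mathscr S(z_0,\theta_0)+\int_0^t\int_\Omega Z^\top\mathbf L(z,\theta)Z\,dx\,ds$. A global generalised dissipative weak solution is a sextuple whose restriction to every finite interval $(0,T)$ is such a solution, with compatible time representatives ($\rho,\eta\in C([0,T];L^2)$, $\mathfrak E$ weak-star continuous in $\mathcal M(\overline\Omega)$) on overlapping intervals. *)

(* Defs.v *)
From HB Require Import structures.
From mathcomp Require Import all_boot all_order all_algebra.
From mathcomp Require Import all_classical all_reals all_analysis.
From mathcomp Require Import measurable_realfun.

Set Implicit Arguments.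
Unset Strict Implicit.
Unset Printing Implicit Defensive.

Import Order.TTheory GRing.Theory Num.Theory.
Import numFieldNormedType.Exports.

Local Open Scope classical_set_scope.
Local Open Scope ring_scope.

(* ------------------------------------------------------------------------- *)
(** * Matrices as a measurable type

    The sigma-algebra is the one generated by the entries.  *)

Definition measure_mx_display : measure_display -> measure_display.
Proof. exact. Qed.

Section measurable_matrix.
Context {d} {T : measurableType d} (m n : nat).

Definition mx_cylinder : set (set 'M[T]_(m, n)) :=
  [set A | exists i j (B : set T),
     measurable B /\ A = (fun M : 'M[T]_(m, n) => M i j) @^-1` B].

Let mx_set0 : <<s mx_cylinder >> set0.
Proof. exact: sigma_algebra0. Qed.

Let mx_setC A : <<s mx_cylinder >> A -> <<s mx_cylinder >> (~` A).
Proof. exact: sigma_algebraC. Qed.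

Let mx_bigcup (F : (set 'M[T]_(m, n))^nat) :
  (forall i, <<s mx_cylinder >> (F i)) -> <<s mx_cylinder >> (\bigcup_i F i).
Proof. exact: sigma_algebra_bigcup. Qed.

HB.instance Definition _ := @isMeasurable.Build (measure_mx_display d)
  'M[T]_(m, n) <<s mx_cylinder >> mx_set0 mx_setC mx_bigcup.

End measurable_matrix.

Lemma measurable_mx_entry d (T : measurableType d) m n (i : 'I_m) (j : 'I_n) :
  measurable_fun setT (fun M : 'M[T]_(m, n) => M i j).
Proof.
move=> _ B mB; rewrite setTI; apply: sub_sigma_algebra.
by exists i, j, B.
Qed.

Lemma measurable_fun_mx d d' (S : measurableType d) (T : measurableType d')
    m n (D : set S) (f : S -> 'M[T]_(m, n)) :
  measurable D ->
  (forall i j, measurable_fun D (fun x => f x i j)) -> measurable_fun D f.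
Proof.
move=> mD mf; apply: (measurability (@mx_cylinder _ T m n)) => //.
by move=> _ [_ [i [j [B [mB ->]]]] <-]; exact: mf.
Qed.

(* ------------------------------------------------------------------------- *)
(** * The flat torus

    [T^d = R^d / Z^d].  Test functions are periodic functions on ['rV[R]_d];
    elements of Lebesgue spaces are functions on ['rV[R]_d] taken modulo
    equality almost everywhere for [torus_measure], the [d]-dimensional
    Lebesgue measure carried by the cell [[0,1)^d], so that only their values
    on the cell matter. *)

Section torus_measure.
Context (R : realType).

Definition circle_measure : set (measurableTypeR R) -> \bar R :=
  mrestr (@lebesgue_measure R) (measurable_itv `[0, 1[).

HB.instance Definition _ := Measure.on circle_measure.

Let circle_measure_setT : circle_measure setT = 1%E.
Proof.
by rewrite /circle_measure /mrestr setTI lebesgue_measure_itv/= lte01 sube0.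
Qed.

HB.instance Definition _ :=
  Measure_isProbability.Build _ _ R circle_measure circle_measure_setT.

Definition row_cons n (p : measurableTypeR R * 'rV[R]_n) : 'rV[R]_n.+1 :=
  row_mx (p.1)%:M p.2 : 'rV[R]_(1 + n).

Lemma measurable_row_cons n : measurable_fun setT (@row_cons n).
Proof.
apply: measurable_fun_mx => // i j; rewrite (ord1 i).
have [k|k] := @split_ordP 1 n j => ->.
  rewrite (_ : (fun x => _) = fst) //.
  by apply/funext => p; rewrite /row_cons (row_mxEl (p.1)%:M) (ord1 k) mxE.
rewrite (_ : (fun x => _) = (fun M : 'rV[R]_n => M 0 k) \o snd).
  by apply: measurableT_comp => //; exact: measurable_mx_entry.
by apply/funext => p; rewrite /row_cons (row_mxEr (p.1)%:M).
Qed.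

HB.instance Definition _ n :=
  isMeasurableFun.Build _ _ _ _ (@row_cons n) (@measurable_row_cons n).

Fixpoint torus_measure (d : nat) : probability 'rV[R]_d R :=
  match d with
  | 0 => \d_(0 : 'rV[R]_0)
  | d'.+1 => distribution (circle_measure \x torus_measure d')%E (@row_cons d')
  end.

End torus_measure.

Section function_spaces.
Context {R : realType} {d : nat}.
Implicit Types (f u phi : 'rV[R]_d -> R) (g gg : 'rV[R]_d -> 'cV[R]_d).
Implicit Types (T t : R).

Definition dot n (v w : 'cV[R]_n) : R := (v^T *m w) 0 0.
Definition sqn n (v : 'cV[R]_n) : R := dot v v.

Definition periodic f : Prop := forall x (i : 'I_d), f (x + delta_mx 0 i) = f x.

Definition partial (i : 'I_d) f : 'rV[R]_d -> R :=
  fun x => 'D_(delta_mx 0 i) f x.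

Definition mpartial (s : seq 'I_d) f : 'rV[R]_d -> R := foldr partial f s.

Definition grad f (x : 'rV[R]_d) : 'cV[R]_d := \col_i partial i f x.

(** [C(T^d)] and [C^oo_per]. *)
Definition cont_per f : Prop := continuous f /\ periodic f.

Definition smooth_per f : Prop :=
  [/\ periodic f, forall s, continuous (mpartial s f) &
      forall s x (i : 'I_d), derivable (mpartial s f) x (delta_mx 0 i)].

(** [C1_curve T v v'] : [v] belongs to [C^1([0,T]; C^oo_per)] and [v'] is its
    time derivative, for the Frechet topology of [C^oo_per] (uniform convergence
    of every partial derivative). *)
Definition C1_curve T (v v' : R -> 'rV[R]_d -> R) : Prop :=
  [/\ forall t, t \in `[0, T] -> smooth_per (v t) /\ smooth_per (v' t),
      forall s t (eps : R), t \in `[0, T] -> 0 < eps ->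
        \forall r \near t, r \in `[0, T] -> forall x,
          `|mpartial s (v' r) x - mpartial s (v' t) x| <= eps &
      forall s t (eps : R), t \in `[0, T] -> 0 < eps ->
        \forall r \near t, r \in `[0, T] -> forall x,
          `|mpartial s (v r) x - mpartial s (v t) x
            - (r - t) * mpartial s (v' t) x| <= eps * `|r - t| ].

(** [C^oo_c((0,T); C^oo_per)]; [vs k] is the [k]-th time derivative. *)
Definition Cc_smooth_curve T (v : R -> 'rV[R]_d -> R) : Prop :=
  (exists vs : nat -> R -> 'rV[R]_d -> R,
     vs 0%N = v /\ forall k, C1_curve T (vs k) (vs k.+1)) /\
  (exists a b : R, [/\ 0 < a, b < T &
     forall t, t \notin `[a, b] -> forall x, v t x = 0]).

Notation mu := (@lebesgue_measure R).
Notation P := (torus_measure R d).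

Definition inner u phi : \bar R := \int[P]_x (u x * phi x)%:E.
Definition innerv g gg : \bar R := \int[P]_x (dot (g x) (gg x))%:E.
Definition time_int T (f : R -> \bar R) : \bar R :=
  \int[mu]_(t in `]0, T[) f t.

(** [g] is the weak gradient of [u]; both are square integrable wherever this
    is used, so that the two integrals are finite. *)
Definition weak_grad u g : Prop := forall phi, smooth_per phi -> forall i : 'I_d,
  inner u (partial i phi) = (- inner (fun x => g x i 0%R) phi)%E.

Definition normH1_sq u g : \bar R := \int[P]_x (u x ^+ 2 + sqn (g x))%:E.
Definition normL2_sq u : \bar R := \int[P]_x (u x ^+ 2)%:E.
Definition normL2v_sq g : \bar R := \int[P]_x (sqn (g x))%:E.
Definition normL1 u : \bar R := \int[P]_x `|u x|%:E.

Definition inL2 u : Prop := measurable_fun setT u /\ (normL2_sq u < +oo)%E.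

Definition inH1 u g : Prop :=
  [/\ measurable_fun setT u, measurable_fun setT g,
      (normH1_sq u g < +oo)%E & weak_grad u g].

(** Bochner spaces.  An element of [L^p(0,T;H^1)] is given by a jointly
    measurable representative together with a jointly measurable representative
    of its spatial weak gradient. *)
Definition time_meas T d' (V : measurableType d') (u : R -> 'rV[R]_d -> V) :=
  measurable_fun (`]0, T[ `*` [set: 'rV[R]_d]) (fun p => u p.1 p.2).

Definition inLooH1 T (u : R -> 'rV[R]_d -> R) (g : R -> 'rV[R]_d -> 'cV[R]_d) :=
  [/\ time_meas T u, time_meas T g,
      {ae mu, forall t, t \in `]0, T[ -> inH1 (u t) (g t)} &
      exists M : R, {ae mu, forall t, t \in `]0, T[ ->
        (normH1_sq (u t) (g t) <= M%:E)%E}].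

Definition inL2H1 T (u : R -> 'rV[R]_d -> R) (g : R -> 'rV[R]_d -> 'cV[R]_d) :=
  [/\ time_meas T u, time_meas T g,
      {ae mu, forall t, t \in `]0, T[ -> inH1 (u t) (g t)} &
      (time_int T (fun t => normH1_sq (u t) (g t)) < +oo)%E].

Definition inL2L2 T (u : R -> 'rV[R]_d -> R) :=
  time_meas T u /\ (time_int T (fun t => normL2_sq (u t)) < +oo)%E.

Definition inLooL1 T (u : R -> 'rV[R]_d -> R) :=
  time_meas T u /\
  exists M : R, {ae mu, forall t, t \in `]0, T[ -> (normL1 (u t) <= M%:E)%E}.

(** [C([0,+oo[; L^2)] *)
Definition contL2 (u : R -> 'rV[R]_d -> R) : Prop :=
  (forall t, 0 <= t -> inL2 (u t)) /\
  (forall t (eps : R), 0 <= t -> 0 < eps ->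
     \forall s \near t, 0 <= s ->
       (normL2_sq (fun x => u s x - u t x)%R <= eps%:E)%E).

End function_spaces.

(* ------------------------------------------------------------------------- *)
(** * Radon measures, as the dual of [C(T^d)] *)

Section radon.
Context (R : realType) (d : nat).

(** The torus being compact without boundary, [C(\overline\Omega) = C(T^d)];
    only the values of [pairing] on [cont_per] functions are meaningful. *)
Record radon := Radon {
  pairing :> ('rV[R]_d -> R) -> R ;
  pairing_linear : forall (a : R) f g, cont_per f -> cont_per g ->
    pairing (fun x => a * f x + g x) = a * pairing f + pairing g ;
  pairing_bounded : exists M : R, forall f, cont_per f ->
    (forall x, `|f x| <= 1) -> `|pairing f| <= M
}.

Definition radon_ge0 (m : radon) : Prop :=
  forall f, cont_per f -> (forall x, 0 <= f x) -> 0 <= m f.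

Definition radon_norm (m : radon) : \bar R :=
  ereal_sup [set `|m f|%:E | f in
    [set f | cont_per f /\ forall x, `|f x| <= 1]].

(** [L^oo_{w*}(0,T; M_+)] *)
Definition inLoo_radon_ge0 (T : R) (l : R -> radon) : Prop :=
  [/\ forall f, cont_per f -> measurable_fun `]0, T[ (fun t => l t f),
      {ae @lebesgue_measure R, forall t, t \in `]0, T[ -> radon_ge0 (l t)} &
      exists M : R, {ae @lebesgue_measure R, forall t, t \in `]0, T[ ->
        (radon_norm (l t) <= M%:E)%E}].

End radon.

(* ------------------------------------------------------------------------- *)
(** * Constitutive functions *)

(** Constitutive functions are defined for positive temperatures and are
    extended by [0]; they are only ever evaluated at almost everywhere positive
    temperatures. *)
Definition on_pos (R : realType) (V : nmodType) (f : R -> V) (th : R) : V :=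
  if 0 < th then f th else 0.

Section potential.
Context (R : realType).

Record potential := Potential {
  q : R ; eps1 : R ; epsq : R ; gam_rho : R ; gam_eta : R ;
  F0 : R -> R -> R ; F1 : R -> R -> R
}.

Definition psi (p : potential) (r h th : R) : R :=
  ln th - eps1 p * th * (ln th - 1) - epsq p / (q p - 1) * th `^ (1 - q p)
  - F0 p r h + th * F1 p r h.

Definition e_int p r h : R -> R := on_pos (fun th => derive1 (psi p r h) th).

Definition s_bulk p r h : R -> R :=
  on_pos (fun th => th * e_int p r h th - psi p r h th).

Definition dpsi_rho p r h : R -> R :=
  on_pos (fun th => derive1 (fun r' => psi p r' h th) r).

Definition dpsi_eta p r h : R -> R :=
  on_pos (fun th => derive1 (fun h' => psi p r h' th) h).

Definition poly_deg4 (F : R -> R -> R) : Prop :=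
  exists c : nat -> nat -> R, forall r h,
    F r h = \sum_(i < 5) \sum_(j < 5 | (i + j <= 4)%N) c i j * r ^+ i * h ^+ j.

Definition d1 (F : R -> R -> R) r h : R := derive1 (fun r' => F r' h) r.
Definition d2 (F : R -> R -> R) r h : R := derive1 (fun h' => F r h') h.

Definition abs2 (r h : R) : R := Num.sqrt (r ^+ 2 + h ^+ 2).

Definition growth4 (F : R -> R -> R) : Prop := exists C : R, forall r h,
  Num.sqrt (d1 F r h ^+ 2 + d2 F r h ^+ 2) <= C * (1 + abs2 r h ^+ 3) /\
  Num.sqrt (d1 (d1 F) r h ^+ 2 + d1 (d2 F) r h ^+ 2
            + d2 (d1 F) r h ^+ 2 + d2 (d2 F) r h ^+ 2)
    <= C * (1 + abs2 r h ^+ 2).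

Definition admissible_potential (d : nat) (p : potential) : Prop :=
  [/\ 1 < q p /\ d%:R <= q p,
      [/\ 0 < eps1 p, 0 < epsq p, 0 < gam_rho p & 0 < gam_eta p],
      (forall r h, 0 <= F0 p r h) /\ (forall r h, 0 <= F1 p r h),
      [/\ poly_deg4 (F0 p), poly_deg4 (F1 p), growth4 (F0 p) & growth4 (F1 p)] &
      exists a c C : R, [/\ 0 < a, 0 < c, 0 < C &
        forall r h, c * abs2 r h ^+ 4 - C <= a * F1 p r h - F0 p r h]].

End potential.

Section mobility.
Context (R : realType) (d : nat).

(** [L r h th] is the mobility at [z = (r, h)] and temperature [th]. *)
Definition mobility := R -> R -> R -> 'M[R]_(d + d + 1).

Definition admissible_mobility (L : mobility) : Prop :=
  [/\ forall r h th, 0 < th ->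
        {for (r, h, th), continuous (fun w : R * R * R => L w.1.1 w.1.2 w.2)},
      exists M : R, forall r h th, 0 < th -> forall i j, `|L r h th i j| <= M,
      forall r h th, 0 < th -> (L r h th)^T = L r h th &
      exists lam0 lam1 : R, [/\ 0 < lam0, lam0 <= lam1 &
        forall r h th (zeta : 'cV[R]_(d + d + 1)), 0 < th ->
          lam0 * sqn zeta <= dot zeta (L r h th *m zeta)
                          <= lam1 * sqn zeta]].

Variable A : 'M[R]_(d + d + 1).

Definition L11 : 'M[R]_d := ulsubmx (ulsubmx A).
Definition L12 : 'M[R]_d := ursubmx (ulsubmx A).
Definition L22 : 'M[R]_d := drsubmx (ulsubmx A).
Definition L13 : 'cV[R]_d := usubmx (ursubmx A).
Definition L23 : 'cV[R]_d := dsubmx (ursubmx A).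
Definition L33 : R := (drsubmx A) 0 0.

(** Here [gm], [gt], [m] stand for the gradient of [mu_rho], the gradient of
    [theta] and the value of [mu_eta]. *)
Variables (gm gt : 'cV[R]_d) (m : R).

Definition flux_rho : 'cV[R]_d := L11 *m gm - L12 *m gt + m *: L13.
Definition flux_e : 'cV[R]_d := L12^T *m gm - L22 *m gt + m *: L23.
Definition rate_eta : R := dot L13 gm - dot L23 gt + L33 * m.

Definition force : 'cV[R]_(d + d + 1) := col_mx (col_mx gm (- gt)) m%:M.
Definition dissip : R := dot force (A *m force).

End mobility.

(* ------------------------------------------------------------------------- *)
(** * Generalised dissipative weak solutions *)

Section solutions.
Context (R : realType) (d : nat).

Record initial_data := InitialData {
  rho0 : 'rV[R]_d -> R ; theta0 : 'rV[R]_d -> R ; eta0 : 'rV[R]_d -> R ;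
  Drho0 : 'rV[R]_d -> 'cV[R]_d ; Deta0 : 'rV[R]_d -> 'cV[R]_d
}.

(** The sextuple, with the weak gradients of its [H^1]-valued components. *)
Record sextuple := Sextuple {
  rho : R -> 'rV[R]_d -> R ; mu_rho : R -> 'rV[R]_d -> R ;
  theta : R -> 'rV[R]_d -> R ; eta : R -> 'rV[R]_d -> R ;
  mu_eta : R -> 'rV[R]_d -> R ; lam : R -> radon R d ;
  Drho : R -> 'rV[R]_d -> 'cV[R]_d ; Dmu_rho : R -> 'rV[R]_d -> 'cV[R]_d ;
  Dtheta : R -> 'rV[R]_d -> 'cV[R]_d ; Deta : R -> 'rV[R]_d -> 'cV[R]_d
}.

Variables (p : potential R) (L : mobility R d).

Notation mu := (@lebesgue_measure R).
Notation P := (torus_measure R d).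

Definition entropy (r th h : 'rV[R]_d -> R) (gr gh : 'rV[R]_d -> 'cV[R]_d) :=
  (\int[P]_x (s_bulk p (r x) (h x) (th x))%:E
   - (gam_rho p / 2)%:E * normL2v_sq gr - (gam_eta p / 2)%:E * normL2v_sq gh)%E.

Definition initial_entropy (i : initial_data) : \bar R :=
  entropy (rho0 i) (theta0 i) (eta0 i) (Drho0 i) (Deta0 i).

Definition e0 (i : initial_data) (x : 'rV[R]_d) : R :=
  e_int p (rho0 i x) (eta0 i x) (theta0 i x).

(** The data for which the quantities in the definition of a solution are
    defined and finite. *)
Definition admissible_data (i : initial_data) : Prop :=
  [/\ inH1 (rho0 i) (Drho0 i), inH1 (eta0 i) (Deta0 i),
      measurable_fun setT (theta0 i) /\ {ae P, forall x, 0 < theta0 i x},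
      P.-integrable setT (fun x => (e0 i x)%:E) &
      P.-integrable setT
        (fun x => (s_bulk p (rho0 i x) (eta0 i x) (theta0 i x))%:E)].

Variable w : sextuple.

Definition mob (t : R) (x : 'rV[R]_d) : 'M[R]_(d + d + 1) :=
  on_pos (L (rho w t x) (eta w t x)) (theta w t x).

Definition J_rho t x := flux_rho (mob t x) (Dmu_rho w t x) (Dtheta w t x) (mu_eta w t x).
Definition J_e t x := flux_e (mob t x) (Dmu_rho w t x) (Dtheta w t x) (mu_eta w t x).
Definition R_eta t x := rate_eta (mob t x) (Dmu_rho w t x) (Dtheta w t x) (mu_eta w t x).
Definition ZLZ t x : R := dissip (mob t x) (Dmu_rho w t x) (Dtheta w t x) (mu_eta w t x).

Definition e_sol t x : R := e_int p (rho w t x) (eta w t x) (theta w t x).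

Definition psi_rho_sol t x : R := dpsi_rho p (rho w t x) (eta w t x) (theta w t x).
Definition psi_eta_sol t x : R := dpsi_eta p (rho w t x) (eta w t x) (theta w t x).

(** The value at [phi] of the energy measure [e dx + lambda_t]. *)
Definition energy_pairing t (phi : 'rV[R]_d -> R) : \bar R :=
  (inner (e_sol t) phi + (lam w t phi)%:E)%E.

(** The integral identities are equations between extended reals.  As
    [+oo + -oo = -oo], for [+%E] and in the definition of the integral alike,
    each of them also asserts that the integrals it contains converge. *)
Record is_solution (T : R) (i : initial_data) : Prop := IsSolution {
  sol_rho : inLooH1 T (rho w) (Drho w) ;
  sol_eta : inLooH1 T (eta w) (Deta w) ;
  sol_mu_rho : inL2H1 T (mu_rho w) (Dmu_rho w) ;
  sol_theta : inL2H1 T (theta w) (Dtheta w) /\ inLooL1 T (theta w) ;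
  sol_theta_inv : inLooL1 T (fun t x => theta w t x `^ (- q p)) ;
  sol_mu_eta : inL2L2 T (mu_eta w) ;
  sol_theta_gt0 : {ae mu, forall t, t \in `]0, T[ ->
    {ae P, forall x, 0 < theta w t x}} ;
  sol_lam : inLoo_radon_ge0 T (lam w) ;
  sol_mass : forall v v', C1_curve T v v' -> (forall x, v T x = 0) ->
    (- time_int T (fun t => inner (rho w t) (v' t))
     - inner (rho0 i) (v 0%R)
     + time_int T (fun t => innerv (J_rho t) (grad (v t))) = 0)%E ;
  sol_energy : forall xi xi', C1_curve T xi xi' -> (forall x, xi T x = 0) ->
    (- time_int T (fun t => inner (e_sol t) (xi' t))
     - time_int T (fun t => (lam w t (xi' t))%:E)
     - inner (e0 i) (xi 0%R)
     + time_int T (fun t => innerv (J_e t) (grad (xi t))) = 0)%E ;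
  sol_order : forall v v', C1_curve T v v' -> (forall x, v T x = 0) ->
    (- time_int T (fun t => inner (eta w t) (v' t))
     - inner (eta0 i) (v 0%R)
     + time_int T (fun t => inner (R_eta t) (v t)) = 0)%E ;
  sol_chem_rho : forall phi, Cc_smooth_curve T phi ->
    (time_int T (fun t => inner (mu_rho w t) (phi t))
     = (gam_rho p)%:E * time_int T (fun t => innerv (Drho w t) (grad (phi t)))
       + time_int T (fun t => inner (psi_rho_sol t) (phi t)))%E ;
  sol_chem_eta : forall chi, Cc_smooth_curve T chi ->
    (time_int T (fun t => inner (mu_eta w t) (chi t))
     = (gam_eta p)%:E * time_int T (fun t => innerv (Deta w t) (grad (chi t)))
       + time_int T (fun t => inner (psi_eta_sol t) (chi t)))%E ;
  sol_entropy : {ae mu, forall t, t \in `]0, T[ ->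
    (initial_entropy i + time_int t (fun s => \int[P]_x (ZLZ s x)%:E)
     <= entropy (rho w t) (theta w t) (eta w t) (Drho w t) (Deta w t))%E}
}.

(** Time-continuous representatives of [rho], [eta] and of the energy measure;
    representatives on the intervals [[0,T]] that agree on overlaps are the
    restrictions of representatives on [[0,+oo[]. *)
Definition continuous_representatives : Prop :=
  [/\ exists2 rt, contL2 rt & {ae mu, forall t, 0 < t ->
        {ae P, forall x, rt t x = rho w t x}},
      exists2 ht, contL2 ht & {ae mu, forall t, 0 < t ->
        {ae P, forall x, ht t x = eta w t x}} &
      exists2 Et : R -> radon R d,
        forall phi, cont_per phi -> {within `[0, +oo[, continuous (fun t => Et t phi)} &
        {ae mu, forall t, 0 < t -> forall phi, cont_per phi ->
          (Et t phi)%:E = energy_pairing t phi}].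

Definition is_global_solution (i : initial_data) : Prop :=
  [/\ admissible_data i, forall T, 0 < T -> is_solution T i &
      continuous_representatives].

End solutions.

(* Main.v *)
(** Testing the energy equation with functions of time only shows that the
    total energy [int e dx + lambda_t(1)] keeps its initial value.  The
    combination [a e - s_bulk] is coercive: [a F1 - F0] controls [|z|^4], and
    [(1 - a eps1) ln theta] and [theta^(1-q)] are absorbed by
    [eps1 theta + a epsq theta^(-q)].  So [a] times the conserved energy minus
    the entropy inequality bounds, by a constant depending only on the data,
    the gradients, [|z|^4], [theta], [theta^(-q)], the mass of [lambda_t] and
    the dissipation up to time [t].  The integrability in [x] of [F0] and
    [|z|^4] is not taken from a Sobolev embedding: [F1] is integrable because
    the energy is finite at almost every time, and the rest is dominated by
    it. *)

Require Import Defs.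
From mathcomp Require Import all_boot all_order all_algebra.
From mathcomp Require Import all_classical all_reals all_analysis.
From mathcomp Require Import measurable_realfun.
From mathcomp Require Import ring lra.

Set Implicit Arguments.
Unset Strict Implicit.
Unset Printing Implicit Defensive.

Import Order.TTheory GRing.Theory Num.Theory.
Import numFieldNormedType.Exports.

Local Open Scope classical_set_scope.
Local Open Scope ring_scope.

(** * Comparison of integrals without measurability *)

(* The integral of a non-negative function is a supremum over the simple
   functions below it, whether or not it is measurable.  Comparing integrals
   this way avoids proving that the space integrals below are measurable
   functions of time. *)
Section integral_without_measurability.
Local Open Scope ereal_scope.
Context d (T : measurableType d) (R : realType).
Variable mu : {measure set T -> \bar R}.
Implicit Types (D : set T) (f g : T -> \bar R).

Import HBNNSimple.

Lemma ge0_integral_le_nnsfun D f (K : \bar R) : (forall x, D x -> 0 <= f x) ->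
  (forall h : {nnsfun T >-> R}, (forall x, (h x)%:E <= (f \_ D) x) ->
    \int[mu]_x (h x)%:E <= K) ->
  \int[mu]_(x in D) f x <= K.
Proof.
move=> f0 hK; rewrite ge0_integralE//; apply: ge_ereal_sup => _ [h hf <-].
by rewrite -integralT_nnsfun; exact: hK.
Qed.

Lemma nnsfun_le_integral D f (h : {nnsfun T >-> R}) :
  (forall x, D x -> 0 <= f x) -> (forall x, (h x)%:E <= (f \_ D) x) ->
  \int[mu]_x (h x)%:E <= \int[mu]_(x in D) f x.
Proof.
move=> f0 hf; rewrite integralT_nnsfun ge0_integralE//.
by apply: ereal_sup_ubound; exists h.
Qed.

Lemma ge0_ae_le_integral_nomeas D f g :
  (forall x, D x -> 0 <= f x) -> (forall x, D x -> 0 <= g x) ->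
  {ae mu, forall x, D x -> f x <= g x} ->
  \int[mu]_(x in D) f x <= \int[mu]_(x in D) g x.
Proof.
move=> f0 g0 [N [mN N0 fgN]]; apply: ge0_integral_le_nnsfun => // h hf.
(* Setting [h] to zero on the null set [N] keeps its integral and puts it below [g] everywhere,
   since [g] is non-negative on [D]. *)
pose h' := mul_nnsfun h (indic_nnsfun R (measurableC mN)).
rewrite (_ : \int[mu]_x (h x)%:E = \int[mu]_x (h' x)%:E).
  apply: (@nnsfun_le_integral _ _ h') => // x.
  rewrite /h'/= /mindic indicE; case: (asboolP ((~` N) x)) => Nx.
    rewrite mem_set//= mulr1; apply: (le_trans (hf x)).
    rewrite !patchE; case: ifPn => // /set_mem Dx.
    by apply: contrapT => H; apply: Nx; apply: fgN => /=; apply: contra_not H; exact.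
  by rewrite memNset//= mulr0; apply: erestrict_ge0.
apply: ge0_ae_eq_integral => //.
- by apply/measurable_EFinP.
- by apply/measurable_EFinP.
- by move=> x _; rewrite lee_fin.
- by move=> x _; rewrite lee_fin.
exists N; split => // x /= H; apply: contrapT => Nx; apply: H => _.
by rewrite /h'/= /mindic indicE mem_set// mulr1.
Qed.

Lemma ae_eq_integral_nomeas D f g : {ae mu, forall x, D x -> f x = g x} ->
  \int[mu]_(x in D) f x = \int[mu]_(x in D) g x.
Proof.
move=> fg.
suff le1 u v : {ae mu, forall x, D x -> u x = v x} ->
    \int[mu]_(x in D) u^\+ x <= \int[mu]_(x in D) v^\+ x /\
    \int[mu]_(x in D) u^\- x <= \int[mu]_(x in D) v^\- x.
  have [p1 n1] := le1 _ _ fg.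
  have [|p2 n2] := le1 g f; first by apply: filterS fg => x + Dx => ->.
  by rewrite integralE [RHS]integralE; congr (_ - _); apply/eqP; rewrite eq_le ?p1 ?n1.
by move=> uv; split; apply: ge0_ae_le_integral_nomeas => //;
  apply: filterS uv => x + Dx => /(_ Dx) uvx; rewrite ?funeposE ?funenegE uvx.
Qed.

(** A simple function below [a * f], divided by [a], is a simple function below [f]. *)
Lemma ge0_integralZl_le D f (a : R) : (0 < a)%R -> (forall x, D x -> 0 <= f x) ->
  \int[mu]_(x in D) (a%:E * f x) <= a%:E * \int[mu]_(x in D) f x.
Proof.
move=> a0 f0; apply: ge0_integral_le_nnsfun => [x Dx|h hf].
  by rewrite mule_ge0 ?f0// lee_fin ltW.
have ai0 : (0 <= a^-1)%R by rewrite invr_ge0 ltW.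
pose h' := scale_nnsfun h ai0.
have -> : \int[mu]_x (h x)%:E = a%:E * \int[mu]_x (h' x)%:E.
  rewrite -ge0_integralZl//; last 3 first.
  - by apply/measurable_EFinP.
  - by move=> x _; rewrite lee_fin.
  - by rewrite lee_fin ltW.
  by apply: eq_integral => x _; rewrite -EFinM/= mulrA divff ?gt_eqF// mul1r.
rewrite lee_pmul2l//; apply: nnsfun_le_integral => // x.
have := hf x; rewrite /h'/= !patchE; case: ifPn => _ hx;
  by rewrite -(@lee_pmul2l _ a%:E)// -EFinM mulrA divff ?gt_eqF// mul1r ?mule0.
Qed.

(** The function [g] may be negative on a null set: its negative part then integrates to zero. This
    suits the coercivity estimate, which holds only where the temperature is positive. *)
Lemma ge0_le_integral_ae D f g : (forall x, D x -> 0 <= f x) ->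
  {ae mu, forall x, D x -> f x <= g x} ->
  \int[mu]_(x in D) f x <= \int[mu]_(x in D) g x.
Proof.
move=> f0 fg; rewrite [leRHS]integralE.
have -> : \int[mu]_(x in D) g^\- x = 0.
  apply/eqP; rewrite eq_le integral_ge0// andbT -(integral0 mu D).
  apply: ge0_ae_le_integral_nomeas => //; apply: filterS fg => x + Dx => /(_ Dx) fg.
  by rewrite funenegE ge_max lexx andbT leeNl oppe0 (le_trans (f0 x Dx)).
rewrite sube0; apply: ge0_ae_le_integral_nomeas => //.
by apply: filterS fg => x + Dx => /(_ Dx); rewrite funeposE le_max => ->.
Qed.

End integral_without_measurability.

(** * Exhaustion of the half-line *)

Section exhaustion.
Import HBNNSimple.

(** As [f] may fail to be measurable, monotone convergence along the intervals []0, n[] is applied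
    to each simple function below it. *)
Lemma ge0_integral_itv0y_le (R : realType) (f : R -> \bar R) (K : \bar R) :
  (forall t, 0 < t -> (0 <= f t)%E) ->
  (forall n : nat, (\int[@lebesgue_measure R]_(t in `]0%R, n%:R%R[) f t <= K)%E) ->
  (\int[@lebesgue_measure R]_(t in `]0%R, +oo[) f t <= K)%E.
Proof.
move=> f0 fK; apply: ge0_integral_le_nnsfun.
  by move=> x /=; rewrite in_itv/= andbT; exact: f0.
move=> h hf.
have h0 x : ~ `]0, +oo[%classic x -> h x = 0.
  move=> Dx; apply/eqP; rewrite eq_le fun_ge0 andbT -lee_fin (le_trans (hf x))//.
  by rewrite patchE memNset.
pose F (n : nat) : set R := `]0, n%:R[%classic.
have -> : (\int[@lebesgue_measure R]_x (h x)%:E =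
    \int[@lebesgue_measure R]_(x in \bigcup_n F n) (h x)%:E)%E.
  rewrite [RHS]integral_mkcond; apply: eq_integral => x _; rewrite patchE.
  case: ifPn => // /negP xN; rewrite h0// => /=; rewrite in_itv/= andbT => x0.
  apply: xN; apply/mem_set; exists (Num.truncn x).+1 => //=.
  by rewrite /F/= in_itv/= x0 truncnS_gt.
have nd : nondecreasing_seq F.
  move=> m n mn; apply/subsetPset => x; rewrite /F/= !in_itv/= => /andP[-> xm]/=.
  by rewrite (lt_le_trans xm)// ler_nat.
have mF n : measurable (F n) by exact: measurable_itv.
have cv : (\int[@lebesgue_measure R]_(x in F i) (h x)%:E @[i --> \oo] -->
    \int[@lebesgue_measure R]_(x in \bigcup_n F n) (h x)%:E)%E.
  apply: ge0_nondecreasing_set_cvg_integral => //.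
  - by move=> n; apply/measurable_EFinP; exact: measurable_funTS.
  - by move=> n x _; rewrite lee_fin.
rewrite -(cvg_lim _ cv)//; apply: lime_le; first by apply/cvg_ex; eexists; exact: cv.
apply: nearW => n; apply: le_trans (fK n).
apply: ge0_ae_le_integral_nomeas.
- by move=> x _; rewrite lee_fin.
- by move=> x; rewrite /F/= in_itv/= => /andP[x0 _]; exact: f0.
apply: aeW => x; rewrite /F/= in_itv/= => /andP[x0 _].
by have := hf x; rewrite patchE mem_set//= in_itv/= x0.
Qed.

End exhaustion.

(** * Closed formulas for energy and entropy, and elementary bounds in the temperature *)

Section potential_estimates.
Context (R : realType).
Implicit Types (p : potential R) (r h th a k : R).

Lemma measurable_poly_deg4 d (T : measurableType d) (F : R -> R -> R)
    (u v : T -> R) : poly_deg4 F ->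
  measurable_fun setT u -> measurable_fun setT v ->
  measurable_fun setT (fun x => F (u x) (v x)).
Proof.
move=> [c Fc] mu mv; under eq_fun do rewrite Fc.
apply: measurable_sum => i; under eq_fun do rewrite big_mkcond.
apply: measurable_sum => j; case: (i + j <= 4)%N => //=.
apply: measurable_funM; first apply: measurable_funM => //;
  exact: measurable_funX.
Qed.

Lemma e_intE p r h th : q p != 1 -> 0 < th ->
  e_int p r h th =
  th^-1 - eps1 p * ln th + epsq p * th `^ (- q p) + F1 p r h.
Proof.
move=> q1 th0; have q10 : q p - 1 != 0 by rewrite subr_eq0.
have Dl := is_derive1_ln th0.
have Dp := is_derive1_powR (1 - q p) th0.
have Di := @is_derive_id R R th 1.
have D1 := is_deriveZ (eps1 p)
  (is_deriveM Di (is_deriveB Dl (is_derive_cst (1 : R) th 1))).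
have D2 := is_deriveZ (epsq p / (q p - 1)) Dp.
case: (is_deriveD (is_deriveB (is_deriveB (is_deriveB Dl D1) D2)
  (is_derive_cst (F0 p r h) th 1)) (is_deriveZ (F1 p r h) Di)) => _.
rewrite (_ : _ + _ = psi p r h); last first.
  apply/funext => x; rewrite /psi !fctE/= /GRing.scale/=.
  by rewrite -[in RHS](mulrC (F1 p r h)) mulrA.
rewrite /e_int /on_pos th0 derive1E => ->; rewrite !fctE /GRing.scale/=.
have -> : 1 - q p - 1 = - q p by rewrite addrAC subrr add0r.
by field; rewrite q10 gt_eqF.
Qed.

(** In [th * e - psi] the terms with [F1] and those with [th * ln th] cancel, and [F0] appears with
    a plus sign. Quartic control in [z] therefore has to come from the energy. *)
Lemma s_bulkE p r h th : q p != 1 -> 0 < th ->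
  s_bulk p r h th =
  1 - ln th - eps1 p * th + epsq p * q p / (q p - 1) * th `^ (1 - q p)
  + F0 p r h.
Proof.
move=> q1 th0; rewrite /s_bulk /on_pos th0 e_intE// /psi.
have q10 : q p - 1 != 0 by rewrite subr_eq0.
have -> : th `^ (1 - q p) = th * th `^ (- q p).
  by rewrite powRD ?powRr1 ?ltW// (gt_eqF th0) implybT.
by field; rewrite q10 gt_eqF.
Qed.

(** The right-hand side is the tangent line of [ln] at [1/k]. *)
Lemma ln_le_linear k th : 0 < k -> 0 < th -> ln th <= k * th - 1 - ln k.
Proof.
move=> k0 th0; rewrite lerBrDr -lnM ?posrE// [th * k]mulrC.
have := expR_ge1Dx (ln (k * th)); rewrite lnK ?posrE ?mulr_gt0//.
by rewrite -lerBrDl.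
Qed.

(** The tangent bound at [th] controls [ln th] from above; at [th ^ (- s)], whose logarithm is
    [- s * ln th], it controls [ln th] from below. *)
Lemma norm_ln_le (s K k : R) : 1 < s -> 0 <= K -> 0 < k ->
  exists C, forall th, 0 < th ->
    K * `|ln th| <= k * (th + th `^ (- s)) + C.
Proof.
move=> s1 K0 k0; have s0 : 0 < s by apply: lt_trans s1.
have K10 : 0 < K + 1 by rewrite ltr_wpDl.
(* The denominator [K + 1] gives [K * e <= k] and remains positive when [K = 0]. *)
set e := k / (K + 1); have e0 : 0 < e by rewrite divr_gt0.
exists (K * `|1 + ln e|) => th th0.
have ts0 : 0 < th `^ (- s) by apply: powR_gt0.
have l1 := ln_le_linear e0 th0.
have l2 := ln_le_linear e0 ts0.
have lnE : ln (th `^ (- s)) = - s * ln th by rewrite ln_powR.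
have n1 : - `|1 + ln e| <= 1 + ln e by rewrite lerNl -normrN ler_norm.
have n0 : 0 <= `|1 + ln e| by [].
have main : `|ln th| <= e * (th + th `^ (- s)) + `|1 + ln e|.
  have p1 : 0 < e * th by rewrite mulr_gt0.
  have p2 : 0 < e * th `^ (- s) by rewrite mulr_gt0.
  rewrite ler_norml mulrDr; apply/andP; split; last by lra.
  (* Since [s > 1], the non-negative bound may be multiplied by [s], and the factor [s] then divided
     out on both sides. *)
  have : s * (- ln th) <= s * (e * th `^ (- s) + `|1 + ln e|).
    have q1 : e * th `^ (- s) + `|1 + ln e| <= s * (e * th `^ (- s) + `|1 + ln e|).
      by rewrite ler_peMl ?ltW//; lra.
    by lra.
  by rewrite ler_pM2l//; lra.
apply: (le_trans (ler_wpM2l K0 main)); rewrite mulrDr lerD2r mulrA.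
rewrite ler_wpM2r//; first by rewrite addr_ge0// ltW.
by rewrite /e mulrCA ger_pMr// ler_pdivrMr// mul1r lerDl.
Qed.

(** Split at [th = e]: below, [th ^ (1 - s) = th * th ^ (- s)] gains a factor at most [e]; above,
    the negative exponent gives the constant [e ^ (1 - s)]. *)
Lemma powR1B_le (s K k : R) : 1 < s -> 0 <= K -> 0 < k ->
  exists C, forall th, 0 < th ->
    K * th `^ (1 - s) <= k * th `^ (- s) + C.
Proof.
move=> s1 K0 k0; have K10 : 0 < K + 1 by rewrite ltr_wpDl.
set e := k / (K + 1); have e0 : 0 < e by rewrite divr_gt0.
have Ke : K * e <= k by rewrite /e mulrCA ger_pMr// ler_pdivrMr// mul1r lerDl.
exists (K * e `^ (1 - s)) => th th0.
have [te|te] := leP th e.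
  have -> : th `^ (1 - s) = th * th `^ (- s).
    by rewrite powRD ?powRr1 ?ltW// (gt_eqF th0) implybT.
  rewrite mulrA ler_wpDr ?mulr_ge0 ?powR_ge0// ler_wpM2r ?powR_ge0//.
  by apply: le_trans Ke; rewrite ler_wpM2l.
rewrite ler_wpDl ?mulr_ge0 ?powR_ge0 ?(ltW k0)// ler_wpM2l//.
rewrite -(opprB s 1) !powRN lef_pV2 ?posrE ?powR_gt0//.
by rewrite ge0_ler_powR// ?nnegrE ?ltW// subr_gt0.
Qed.

End potential_estimates.

(** * Pointwise coercivity and domination of the entropy density *)

Section energy_entropy.
Context (R : realType) (d : nat) (p : potential R).
Hypothesis hp : admissible_potential d p.

Lemma admissible_q_neq1 : q p != 1.
Proof. by case: hp => -[q1 _] _ _ _ _; rewrite gt_eqF. Qed.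

(** The coefficient of [th ^ (1 - q)] in [s_bulk]. *)
Let b := epsq p * q p / (q p - 1).

Let b_ge0 : 0 <= b.
Proof.
case: hp => -[q1 _] [_ ? _ _] _ _ _; have ? : 0 < q p by apply: lt_trans q1.
by rewrite /b divr_ge0 ?mulr_ge0 ?subr_ge0 ?ltW.
Qed.

Lemma energy_entropy_coercive : exists a k C : R, [/\ 0 < a, 0 < k &
  forall r h th, 0 < th -> k * (abs2 r h ^+ 4 + th + th `^ (- q p)) <=
    a * e_int p r h th - s_bulk p r h th + C].
Proof.
case: (hp) => -[q1 _] [e1 eq _ _] _ _ [a [c [C0 [a0 c0 C00 F01]]]].
(* [m1] is half the coefficient of [th] in [- s_bulk], and [m2] a quarter of that of
   [T = th ^ (- q)] in [a * e]. The logarithm costs at most [m * (th + T)] and the power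
   [th ^ (1 - q)] at most [m2 * T], up to constants, so at least [m * (th + T)] is left. *)
pose m1 := eps1 p / 2; pose m2 := a * epsq p / 4.
have m10 : 0 < m1 by rewrite /m1 divr_gt0.
have m20 : 0 < m2 by rewrite /m2 divr_gt0 ?mulr_gt0.
pose m := Num.min m1 m2.
have m0 : 0 < m by rewrite /m lt_min m10.
have mm1 : m <= m1 by rewrite /m ge_min lexx.
have mm2 : m <= m2 by rewrite /m ge_min lexx orbT.
have [C1 lnC1] := norm_ln_le q1 (normr_ge0 (1 - a * eps1 p)) m0.
have [C2 powC2] := powR1B_le q1 b_ge0 m20.
exists a, (Num.min c m), (C0 + 1 + C1 + C2); split => // [|r h th th0].
  by rewrite lt_min c0.
have z0 : 0 <= abs2 r h ^+ 4 by rewrite exprn_ge0// sqrtr_ge0.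
have kc : Num.min c m <= c by rewrite ge_min lexx.
have km : Num.min c m <= m by rewrite ge_min lexx orbT.
rewrite e_intE ?s_bulkE ?admissible_q_neq1//.
have {}powC2 := powC2 _ th0; have {}lnC1 := lnC1 _ th0.
have {}F01 := F01 r h.
rewrite -/b.
have T0 : 0 < th `^ (- q p) by rewrite powR_gt0.
set T := th `^ (- q p) in T0 lnC1 powC2 *.
set S := th `^ (1 - q p) in powC2 *.
set Z := abs2 r h ^+ 4 in z0 F01 *.
have lnlb : - ((1 - a * eps1 p) * ln th) <= m * (th + T) + C1.
  by apply: le_trans lnC1; rewrite -normrM -normrN ler_norm.
have ith : 0 <= a * th^-1 by rewrite mulr_ge0 ?invr_ge0 ?(ltW a0) ?(ltW th0).
have k1 : Num.min c m * Z <= c * Z by rewrite ler_wpM2r.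
have k2 : Num.min c m * (th + T) <= m * (th + T).
  by rewrite ler_wpM2r// addr_ge0 ?(ltW T0) ?(ltW th0).
have k3 : m * th <= m1 * th by rewrite ler_wpM2r ?(ltW th0).
have k4 : m * T <= m2 * T by rewrite ler_wpM2r ?(ltW T0).
have k5 : 0 <= m2 * T by rewrite mulr_ge0 ?(ltW T0) ?(ltW m20).
rewrite /m1 in k3; rewrite /m2 in k4 k5 powC2.
clear -k5 T0 F01 lnlb ith k1 k2 k3 k4 powC2 th0.
set M := Num.min c m in k1 k2 *.
lra.
Qed.

(** This makes the entropy density integrable once [th], [th ^ (- q)] and [e] are. Coercivity bounds
    [F0] by [a * F1 + C0], and [F1 <= |e| + eps1 * |ln th|] because the other terms of [e] are
    non-negative. *)
Lemma norm_s_bulk_le : exists2 C : R, 0 <= C & forall r h th,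
  `|s_bulk p r h th| <=
    C * (1 + `|th| + th `^ (- q p) + `|e_int p r h th|).
Proof.
case: (hp) => -[q1 _] [e1 eq _ _] [F00 F10] _ [a [c [C0 [a0 c0 C00 F01]]]].
(* [1 + a * eps1] is the total weight of [|ln th|]: [1] from [s_bulk] itself, [a * eps1] from the
   bound on [F0]. *)
have K0 : 0 <= 1 + a * eps1 p by rewrite addr_ge0// mulr_ge0 ?ltW.
have [C1 lnC1] := norm_ln_le q1 K0 (ltr01 : 0 < 1 :> R).
have [C2 powC2] := powR1B_le q1 b_ge0 (ltr01 : 0 < 1 :> R).
pose C := 4 + eps1 p + a + C0 + `|C1| + `|C2|.
have C10 : 0 <= `|C1| by []. have C20 : 0 <= `|C2| by [].
exists C => [|r h th]; first by rewrite /C; lra.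
have T0 : 0 <= th `^ (- q p) by rewrite powR_ge0.
(* At non-positive temperature [on_pos] gives [s_bulk] the value [0]. *)
have [th0|th0] := leP th 0.
  rewrite {1}/s_bulk /on_pos ltNge th0/= normr0 mulr_ge0//; first by rewrite /C; lra.
  by rewrite !addr_ge0.
rewrite (gtr0_norm th0).
have {}powC2 := powC2 _ th0; have {}lnC1 := lnC1 _ th0.
have {}F01 := F01 r h.
have z0 : 0 <= c * abs2 r h ^+ 4.
  by rewrite mulr_ge0 ?exprn_ge0 ?sqrtr_ge0 ?ltW.
have ith : 0 <= th^-1 by rewrite invr_ge0 ltW.
have l1 : C1 <= `|C1| by exact: ler_norm.
have l2 : C2 <= `|C2| by exact: ler_norm.
have F1e : F1 p r h <= `|e_int p r h th| + eps1 p * `|ln th|.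
  apply: le_trans (_ : e_int p r h th + eps1 p * ln th <= _); last first.
    by rewrite lerD ?ler_norm// ler_wpM2l ?ler_norm ?(ltW e1).
  have : 0 <= epsq p * th `^ (- q p) by rewrite mulr_ge0 ?(ltW eq).
  rewrite e_intE ?admissible_q_neq1//; lra.
set E := `|e_int p r h th| in F1e *.
have E0 : 0 <= E by rewrite /E.
rewrite s_bulkE ?admissible_q_neq1// -/b.
have F0le : F0 p r h <= a * E + a * eps1 p * `|ln th| + C0.
  have := ler_wpM2l (ltW a0) F1e.
  by lra.
have {}F00 := F00 r h.
set T := th `^ (- q p) in T0 powC2 lnC1 *.
have bS0 : 0 <= b * th `^ (1 - q p) by rewrite mulr_ge0 ?powR_ge0.
have n0 : 0 <= `|ln th| by [].
have : `|1 - ln th - eps1 p * th + b * th `^ (1 - q p) + F0 p r h| <=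
   1 + `|ln th| + eps1 p * th + b * th `^ (1 - q p) + F0 p r h.
  have et : 0 <= eps1 p * th by rewrite mulr_ge0 ?(ltW e1) ?(ltW th0).
  have := ler_norm (ln th). have := ler_norm (- ln th). rewrite normrN => h1 h2.
  by rewrite ler_norml; apply/andP; split; lra.
move=> /le_trans; apply.
have c1 : 0 <= C * T - 2 * T by rewrite -mulrBl mulr_ge0// /C; lra.
have c2 : 0 <= C * th - (1 + eps1 p) * th.
  by rewrite -mulrBl mulr_ge0 ?(ltW th0)// /C; lra.
have c3 : 0 <= C * E - a * E by rewrite -mulrBl mulr_ge0// /C; lra.
have c4 : 1 + C0 + `|C1| + `|C2| <= C by rewrite /C; lra.
by lra.
Qed.

Lemma measurable_e_int d' (T : measurableType d') (u v th : T -> R) :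
  measurable_fun setT u -> measurable_fun setT v -> measurable_fun setT th ->
  measurable_fun setT (fun x => e_int p (u x) (v x) (th x)).
Proof.
move=> mu mv mth; case: (hp) => _ _ _ [_ P1 _ _] _.
(* The inverse is written as the power with exponent [-1], so that measurability of powers covers
   it. *)
rewrite (_ : (fun x => _) = (fun x => if 0 < th x then
  th x `^ (-1) - eps1 p * ln (th x) + epsq p * th x `^ (- q p) + F1 p (u x) (v x)
  else 0)); last first.
  apply/funext => x; case: ifPn => [th0|].
    by rewrite powR_inv1 ?(ltW th0)// e_intE ?admissible_q_neq1.
  by rewrite /e_int /on_pos => /negbTE ->.
apply: measurable_fun_ifT => //; first exact: measurable_fun_ltr.
apply: measurable_funD; last exact: measurable_poly_deg4.
apply: measurable_funD.
  apply: measurable_funB; first exact: (measurableT_comp (measurable_powR _)).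
  by apply: measurable_funM => //; exact: measurableT_comp.
apply: measurable_funM => //.
exact: (measurableT_comp (measurable_powR _)).
Qed.

Lemma measurable_s_bulk d' (T : measurableType d') (u v th : T -> R) :
  measurable_fun setT u -> measurable_fun setT v -> measurable_fun setT th ->
  measurable_fun setT (fun x => s_bulk p (u x) (v x) (th x)).
Proof.
move=> mu mv mth; case: (hp) => _ _ _ [P0 _ _ _] _.
rewrite (_ : (fun x => _) = (fun x => if 0 < th x then
  1 - ln (th x) - eps1 p * th x + b * th x `^ (1 - q p) + F0 p (u x) (v x)
  else 0)); last first.
  apply/funext => x; case: ifPn => [th0|]; first exact: s_bulkE admissible_q_neq1 th0.
  by rewrite /s_bulk /on_pos => /negbTE ->.
apply: measurable_fun_ifT => //; first exact: measurable_fun_ltr.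
apply: measurable_funD; last exact: measurable_poly_deg4.
apply: measurable_funD.
  apply: measurable_funB; last exact: measurable_funM.
  by apply: measurable_funB => //; exact: measurableT_comp.
apply: measurable_funM => //.
exact: (measurableT_comp (measurable_powR _)).
Qed.

End energy_entropy.

(** * Finite integrals, primitives and continuous extension in time *)

(** The integral is the difference of those of the positive and negative parts, and
    [+oo - +oo = -oo]; a finite value thus forces both to be finite. *)
Lemma fin_num_integrable d (T : measurableType d) (R : realType)
    (mu : {measure set T -> \bar R}) (D : set T) (f : T -> \bar R) :
  measurable D -> measurable_fun D f ->
  (\int[mu]_(x in D) f x)%E \is a fin_num -> mu.-integrable D f.
Proof.
move=> mD mf; rewrite integralE => fin.
have p0 : (0 <= \int[mu]_(x in D) f^\+ x)%E by exact: integral_ge0.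
have n0 : (0 <= \int[mu]_(x in D) f^\- x)%E by exact: integral_ge0.
apply/integrableP; split => //.
under eq_integral do rewrite -/((abse \o f) _) (fune_abse f).
rewrite ge0_integralD//; [|exact: measurable_funepos|exact: measurable_funeneg].
by move: fin p0 n0; case: (integral mu D f^\+%E) => [u||]//;
  case: (integral mu D f^\-%E) => [v||]// _ _ _; rewrite -EFinD ltry.
Qed.

(** Supplies the test function in time: the primitive is normalised to vanish at the final time. *)
Lemma continuous_primitive (R : realType) (g : R -> R) (T : R) : 0 < T ->
  continuous g -> exists G : R -> R, [/\
    forall t, 0 <= t <= T -> is_derive t 1 G (g t),
    G T = 0,
    (@lebesgue_measure R).-integrable `]0, T[ (EFin \o g) &
    - G 0 = \int[@lebesgue_measure R]_(t in `]0, T[) g t].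
Proof.
move=> T0 cg.
have gi a b : (@lebesgue_measure R).-integrable `[a, b] (EFin \o g).
  apply: continuous_compact_integrable; first exact: segment_compact.
  exact: continuous_subspaceT.
have gi1 a b x y : (@lebesgue_measure R).-integrable
    [set` Interval (BSide x a) (BSide y b)] (EFin \o g).
  apply: integrableS (gi a b) => //; apply: subset_itv; rewrite bnd_simp//;
  by case: x; case: y; rewrite ?bnd_simp.
(* Starting at [-1] makes [0] an interior point, so that the derivative there is two-sided; [T + 1]
   plays the same role at the other end. *)
pose F x := \int[@lebesgue_measure R]_(t in `[-1, x]) g t.
have N1 : (-1 : R) < 0 by rewrite ltrN10.
exists (fun t => F t - F T); split.
- move=> t /andP[t0 tT].
  have tT1 : t < T + 1 by rewrite (le_lt_trans tT)// ltrDl.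
  have [dF F'] : derivable F t 1 /\ derive1 F t = g t.
    apply: (continuous_FTC1_closed tT1 (gi _ _)); last exact: cg.
    exact: lt_le_trans t0.
  have DF : is_derive t 1 F (g t) by split; rewrite // -derive1E.
  rewrite -[g t]subr0; apply: (is_deriveB DF (is_derive_cst (F T) t 1)).
- by rewrite subrr.
- exact: gi1.
- rewrite opprB /F (Rintegral_itvB (gi1 _ _ _ _)) ?bnd_simp ?ltW//.
  by rewrite -Rintegral_itv_bndo_bndc//; exact: gi1.
Qed.

(** Extension by the value at [0] to negative times gives a function continuous on the whole line,
    as [continuous_primitive] requires. *)
Lemma continuous_extend_itvcy (R : realType) (f : R -> R) :
  {within `[0, +oo[, continuous f} -> continuous (fun t : R => f (Num.max 0 t)).
Proof.
move=> /continuous_within_itvcyP[cf cf0] t.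
apply/cvgrPdist_le => e e0.
have [t0|t0|->] := ltgtP t 0.
- have : \forall s \near t, s < 0 by exact: lt_nbhsl.
  apply: filterS => s s0.
  by rewrite !(max_idPl _) ?(ltW s0) ?(ltW t0)// subrr normr0 ltW.
- have : \forall s \near t, 0 < s by exact: lt_nbhsr.
  have : {for t, continuous f} by apply: cf; rewrite in_itv/= t0.
  move=> /cvgrPdist_le/(_ e e0); apply: filterS2 => s hs s0.
  by rewrite !(max_idPr _) ?(ltW s0) ?(ltW t0).
- move/cvgrPdist_le : cf0 => /(_ e e0).
  rewrite /at_right /within /= => hs.
  have : \forall s \near (0 : R), 0 < s -> `|f 0 - f s| <= e by exact: hs.
  apply: filterS => {hs} s hs; have [s0|s0] := leP s 0.
    by rewrite subrr normr0 ltW.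
  exact: hs.
Qed.

(** * Test functions constant in space, and the mass of a Radon measure *)

Section space_constant_curves.
Context (R : realType) (d : nat).

Lemma mpartial_cst (s : seq 'I_d) (c : R) :
  mpartial s (fun _ : 'rV[R]_d => c) = fun _ => if s is [::] then c else 0.
Proof.
elim: s => //= j s IH; rewrite IH; apply/funext => x /=.
exact: derive_cst.
Qed.

Lemma smooth_per_cst (c : R) : smooth_per (fun _ : 'rV[R]_d => c).
Proof.
split=> [x j//|s|s x j]; rewrite mpartial_cst; first exact: cst_continuous.
exact: derivable_cst.
Qed.

Lemma cont_per_cst (c : R) : cont_per (fun _ : 'rV[R]_d => c).
Proof. by split=> //; exact: cst_continuous. Qed.

(** Spatial derivatives of positive order vanish, so only continuity of [g] and the difference
    quotient of [G] matter. *)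
Lemma C1_curve_cst (T : R) (G g : R -> R) : continuous g ->
  (forall t, 0 <= t <= T -> is_derive t 1 G (g t)) ->
  C1_curve T (fun t (_ : 'rV[R]_d) => G t) (fun t _ => g t).
Proof.
move=> cg DG; split.
- by move=> t _; split; exact: smooth_per_cst.
- move=> s t e _ e0; have /cvgrPdist_le/(_ e e0) := cg t.
  apply: filterS => r hr _ x; rewrite !mpartial_cst.
  by case: s => [|? ?]; rewrite ?subrr ?normr0 ?(ltW e0)// distrC.
- move=> s t e tT e0.
  have [dG G'] := DG t tT.
  have := dG; rewrite /derivable => /cvg_ex[l hl].
  have lE : l = g t by rewrite -G' /derive; apply/esym/cvg_lim.
  move: hl; rewrite lE => /cvgrPdist_le/(_ e e0).
  rewrite /dnbhs /within /= => /nbhs_ballP[del del0 hdel].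
  apply/nbhs_ballP; exists del => // r tr _ x; rewrite !mpartial_cst.
  case: s => [|? ?]; last by rewrite mulr0 !subr0 normr0 mulr_ge0 ?(ltW e0).
  have [->|rt] := eqVneq r t; first by rewrite !subrr mul0r subr0 normr0 mulr0.
  have rt0 : r - t != 0 by rewrite subr_eq0.
  have := hdel (r - t); rewrite /ball/= sub0r normrN distrC => /(_ tr rt0).
  rewrite /GRing.scale/= mulr1 subrK => h.
  rewrite (_ : _ - _ - _ = - ((r - t) * (g t - (r - t)^-1 * (G r - G t)))).
    by rewrite normrN normrM [leRHS]mulrC -(distrC r) ler_wpM2l.
  by field.
Qed.

Lemma grad_cst (c : R) (x : 'rV[R]_d) : grad (fun _ => c) x = 0.
Proof.
apply/colP => j; rewrite !mxE.
exact: derive_cst.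
Qed.

Lemma pairing_cst (l : radon R d) (c : R) : l (fun _ => c) = c * l (fun _ => 1).
Proof.
have l0 : l (fun _ => 0) = 0.
  have := pairing_linear l 1 (cont_per_cst 0) (cont_per_cst 0).
  under [X in pairing l X]eq_fun do rewrite mul1r addr0.
  by move=> /eqP; rewrite mul1r eq_sym -subr_eq0 addrK => /eqP.
have := pairing_linear l c (cont_per_cst 1) (cont_per_cst 0).
by under [X in pairing l X]eq_fun do rewrite mulr1 addr0; rewrite l0 addr0.
Qed.

(** If [|f| <= 1], then [1 + f] and [1 - f] are both non-negative, so positivity gives
    [|l f| <= l 1]. *)
Lemma radon_norm_le (l : radon R d) : radon_ge0 l ->
  (radon_norm l <= (l (fun _ => 1))%:E)%E.
Proof.
move=> l0; apply: ge_ereal_sup => _ [f [[cf pf] f1] <-]; rewrite lee_fin.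
have lin (s : R) : l (fun x => s * f x + 1) = s * l f + l (fun _ => 1).
  by apply: pairing_linear; [split|exact: cont_per_cst].
have c1 s : cont_per (fun x => s * f x + 1).
  split=> [x|x j]; last by rewrite pf.
  apply: (@continuousD _ _ _ (fun x => s * f x) (fun=> 1)); last exact: cst_continuous.
  by apply: (@continuousM _ _ (fun=> s) f); [exact: cst_continuous|exact: cf].
have p1 : 0 <= l (fun x => 1 * f x + 1).
  by apply: l0 => // x; have := f1 x; rewrite ler_norml mul1r => /andP[]; lra.
have p2 : 0 <= l (fun x => -1 * f x + 1).
  by apply: l0 => // x; have := f1 x; rewrite ler_norml mulN1r => /andP[]; lra.
by rewrite lin in p1; rewrite lin in p2; rewrite ler_norml; apply/andP; split; lra.
Qed.

End space_constant_curves.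

#[local] Instance ae_lebesgue_filter (R : realType) :
  Filter (nbhs (almost_everywhere (@lebesgue_measure R))).
Proof. exact: ae_filter_ringOfSetsType. Qed.

(** Countably many intervals []0, n + 1[] suffice, and a countable union of null sets is null. *)
Lemma ae_gt0_of_bounded (R : realType) (Q : R -> Prop) :
  (forall T, 0 < T ->
    {ae @lebesgue_measure R, forall t, t \in `]0, T[ -> Q t}) ->
  {ae @lebesgue_measure R, forall t, 0 < t -> Q t}.
Proof.
move=> hQ.
have : {ae @lebesgue_measure R, forall t, forall n : nat,
    t \in `]0, n.+1%:R[ -> Q t}.
  by apply: ae_foralln => n; exact: hQ.
apply: filterS => t ht t0; apply: (ht (Num.truncn t)).
by rewrite in_itv/= t0 truncnS_gt.
Qed.

(** * Time slices of a global solution and conservation of energy *)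

Section global_solution.
Context (R : realType) (d : nat) (p : potential R).
Hypothesis hp : admissible_potential d p.
Context (L : mobility R d) (i : initial_data R d) (w : sextuple R d).
Hypothesis hw : is_global_solution p L w i.

Notation mu := (@lebesgue_measure R).
Notation P := (torus_measure R d).

Lemma time_meas_slice d' (V : measurableType d') T (u : R -> 'rV[R]_d -> V) t :
  time_meas T u -> t \in `]0, T[ -> measurable_fun setT (u t).
Proof.
move=> mu_ tT; have mT : measurable (`]0, T[ `*` [set: 'rV[R]_d]).
  by apply: measurableX => //; exact: measurable_itv.
apply: (measurable_comp mT _ mu_ (_ : measurable_fun setT (pair t))) => //.
by move=> _ [x _ <-]; split.
Qed.

(** Collects in one null set of times the exceptions to all the properties of a solution used at a
    fixed time. *)
Lemma regular_slices : {ae mu, forall t, 0 < t ->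
  [/\ inH1 (rho w t) (Drho w t), inH1 (eta w t) (Deta w t),
      inH1 (theta w t) (Dtheta w t), inH1 (mu_rho w t) (Dmu_rho w t)
    & measurable_fun setT (mu_eta w t)] /\
  [/\ (normL1 (theta w t) < +oo)%E,
      (normL1 (fun x => theta w t x `^ (- q p))%R < +oo)%E,
      {ae P, forall x, 0 < theta w t x}, radon_ge0 (lam w t)
    & (initial_entropy p i + time_int t (fun s => \int[P]_x (ZLZ L w s x)%:E)
       <= entropy p (rho w t) (theta w t) (eta w t) (Drho w t) (Deta w t))%E]}.
Proof.
case: hw => _ sol _; apply: ae_gt0_of_bounded => T T0.
case: (sol _ T0) => -[_ _ hr _] [_ _ he _] [_ _ hm _] [[_ _ ht _] [_ [M ht1]]]
  [_ [M' hq1]] [mme _] tpos [_ hl _] _ _ _ _ _ hS.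
apply: filter_app hS; apply: filter_app hl; apply: filter_app tpos.
apply: filter_app hq1; apply: filter_app ht1; apply: filter_app hm.
apply: filter_app ht; apply: filter_app he; apply: filter_app hr.
apply: aeW => t c1 c2 c3 b1 b2 b3 a1 a2 a3 tT.
split; split.
- exact: c1.
- exact: c2.
- exact: c3.
- exact: b1.
- exact: time_meas_slice mme tT.
- by rewrite (le_lt_trans (b2 tT))// ltry.
- by rewrite (le_lt_trans (b3 tT))// ltry.
- exact: a1.
- exact: a2.
- exact: a3.
Qed.

Lemma energy_integrable (Et : R -> radon R d) :
  {ae mu, forall t, 0 < t -> forall phi, cont_per phi ->
    (Et t phi)%:E = energy_pairing p w t phi} ->
  {ae mu, forall t, 0 < t -> P.-integrable setT (EFin \o e_sol p w t) /\
    Et t (fun _ => 1) = \int[P]_x e_sol p w t x + lam w t (fun _ => 1)}.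
Proof.
move=> hE; move: regular_slices hE; apply: filterS2 => t ms hE t0.
have [[[mr _ _ _] [me _ _ _] [mt _ _ _] _ _] _] := ms t0.
(* The energy pairing is a real number, so that the integral of [e] is finite. *)
have := hE t0 _ (cont_per_cst d 1); rewrite /energy_pairing /inner.
under eq_integral do rewrite mulr1.
move=> EtE.
have fin : (\int[P]_x (e_sol p w t x)%:E)%E \is a fin_num.
  by move: EtE; case: (integral _ _ _).
have ie : P.-integrable setT (EFin \o e_sol p w t).
  apply: fin_num_integrable => //; apply/measurable_EFinP.
  exact: (measurable_e_int hp).
split=> //; apply/EFin_inj; rewrite EtE EFinD; congr (_ + _)%E.
by rewrite /Rintegral fineK.
Qed.

Lemma inner_cst (u : 'rV[R]_d -> R) (c : R) :
  P.-integrable setT (EFin \o u) ->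
  inner u (fun _ => c) = (c * \int[P]_x u x)%:E.
Proof.
move=> iu; rewrite /inner; under eq_integral do rewrite mulrC EFinM.
rewrite integralZl// EFinM /Rintegral fineK//.
exact: integrable_fin_num.
Qed.

Lemma energy_conserved : {ae mu, forall t, 0 < t ->
  P.-integrable setT (EFin \o e_sol p w t) /\
  \int[P]_x e_sol p w t x + lam w t (fun _ => 1) = \int[P]_x e0 p i x}.
Proof.
case: (hw) => -[_ _ _ ie0 _] sol [_ _ [Et cEt hEt]].
have hE := energy_integrable hEt.
set E0 := \int[P]_x e0 p i x.
pose E t := Et (Num.max 0 t) (fun _ => 1).
have cE : continuous E.
  apply: (@continuous_extend_itvcy R (fun t => Et t (fun _ => 1))).
  exact/cEt/cont_per_cst.
suff hEE0 : {ae mu, forall t, 0 < t -> E t = E0}.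
  move: hE hEE0; apply: filterS2 => t hE hEE0 t0; have [ie EtE] := hE t0.
  by split => //; rewrite -EtE -(hEE0 t0) /E (max_idPr (ltW t0)).
apply: ae_gt0_of_bounded => T T0.
(* Taking as test function a primitive of [E - E0] vanishing at [T], the energy
   equation becomes [int_0^T (E - E0)^2 = 0]. *)
pose g t := E t - E0.
have cg : continuous g.
  by move=> t; apply: continuousB; [exact: cE|exact: cst_continuous].
have [G [DG GT ig G0]] := continuous_primitive T0 cg.
have [_ _ _ _ _ _ _ [ml _ _] _ Heq _ _ _ _] := sol _ T0.
have mg : measurable_fun `]0, T[ g.
  by apply: measurable_funTS; exact: continuous_measurable_fun.
have mE : measurable_fun `]0, T[ E.
  by apply: measurable_funTS; exact: continuous_measurable_fun.
pose l t := lam w t (fun _ => 1).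
have {}ml : measurable_fun `]0, T[ l by apply: ml; exact: cont_per_cst.
have := Heq _ _ (C1_curve_cst d cg DG) (fun _ => GT).
(* The bulk energy equals [E - l] at almost every time. Both [E] and [l] are measurable in time,
   which makes the new integrand measurable. *)
have -> : time_int T (fun t => inner (e_sol p w t) (fun _ => g t)) =
    (\int[mu]_(t in `]0%R, T[) (g t * (E t - l t))%:E)%E.
  apply: ae_eq_integral_nomeas; move: hE; apply: filterS => t hE /=.
  rewrite in_itv/= => /andP[t0 _]; have [ie EtE] := hE t0.
  by rewrite inner_cst// /E (max_idPr (ltW t0)) EtE addrK.
have -> : time_int T (fun t => (lam w t (fun _ => g t))%:E) =
    (\int[mu]_(t in `]0%R, T[) (g t * l t)%:E)%E.
  by apply: eq_integral => t _; rewrite pairing_cst.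
rewrite inner_cst//.
have -> : time_int T (fun t => innerv (J_e L w t) (grad (fun _ => G t))) = 0%E.
  apply: integral0_eq => t _; apply: integral0_eq => x _.
  by rewrite grad_cst /dot mulmx0 mxE.
rewrite adde0 -/E0.
have mA : measurable_fun `]0, T[ (fun t => g t * (E t - l t)).
  by apply: measurable_funM => //; exact: measurable_funB.
have mB : measurable_fun `]0, T[ (fun t => g t * l t) by exact: measurable_funM.
set A := (\int[mu]_(t in _) (g t * (E t - _))%:E)%E.
set B := (\int[mu]_(t in _) (g t * l t)%:E)%E.
move=> ABE.
(* An infinite [A] or [B] would make the left-hand side of the energy equation infinite, whatever
   the other is. *)
have [Afin Bfin] : A \is a fin_num /\ B \is a fin_num.
  by move: ABE; case: (A) => [?||]; case: (B) => [?||].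
have iA : mu.-integrable `]0, T[ (fun t => (g t * (E t - l t))%:E).
  by apply: fin_num_integrable => //; exact/measurable_EFinP.
have iB : mu.-integrable `]0, T[ (fun t => (g t * l t)%:E).
  by apply: fin_num_integrable => //; exact/measurable_EFinP.
have iC : mu.-integrable `]0, T[ (fun t => (E0 * g t)%:E).
  exact: (integrableZl _ E0 ig).
(* Here [g^2 = g * (E - l) + g * l - E0 * g]. The energy equation gives [A + B = - G 0 * E0], which
   is also the integral of [E0 * g]. *)
have gg0 : (\int[mu]_(t in `]0%R, T[) `|(g t * g t)%:E| = 0)%E.
  have -> : (\int[mu]_(t in `]0%R, T[) `|(g t * g t)%:E| =
     \int[mu]_(t in `]0%R, T[) (((g t * (E t - l t))%:E + (g t * l t)%:E)
       - (E0 * g t)%:E))%E.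
    apply: eq_integral => t _; rewrite gee0_abs ?lee_fin -?expr2 ?sqr_ge0//.
    apply: (congr1 EFin (_ : _ = g t * (E t - l t) + g t * l t - E0 * g t)).
    by rewrite /g; ring.
  rewrite integralB//; last exact: integrableD.
  rewrite integralD// -/A -/B.
  have -> : (\int[mu]_(t in `]0%R, T[) (E0 * g t)%:E = (- G 0 * E0)%:E)%E.
    under eq_integral do rewrite EFinM.
    rewrite integralZl// G0 mulrC EFinM; congr (_ * _)%E.
    by rewrite /Rintegral fineK//; exact: integrable_fin_num ig.
  move: ABE Afin Bfin; case: (A) => [a||]//; case: (B) => [b||]// ABE _ _.
  have ab : - a - b - G 0 * E0 = 0 := EFin_inj ABE.
  by apply: (congr1 EFin (_ : a + b - - G 0 * E0 = 0)); lra.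
have mgg : measurable_fun `]0, T[ (fun t => (g t * g t)%:E).
  by apply/measurable_EFinP; exact: measurable_funM.
have : \forall t \ae mu, `]0, T[%classic t -> (g t * g t)%:E = cst 0%E t.
  by apply/ae_eq_integral_abs.
apply: filterS => t h tT.
have /eqP : g t * g t = 0 := EFin_inj (h tT).
by rewrite mulf_eq0 orbb /g subr_eq0 => /eqP.
Qed.

End global_solution.

(** * Enlarging the time interval, choosing good times, and squared norms *)

Lemma ge0_subset_integral_nomeas d (T : measurableType d) (R : realType)
    (mu : {measure set T -> \bar R}) (A B : set T) (f : T -> \bar R) :
  A `<=` B -> (forall x, B x -> (0 <= f x)%E) ->
  (\int[mu]_(x in A) f x <= \int[mu]_(x in B) f x)%E.
Proof.
move=> AB f0; rewrite integral_mkcond [leRHS]integral_mkcond.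
have fB x : (0 <= (f \_ B) x)%E by exact: erestrict_ge0.
have fA x : (0 <= (f \_ A) x)%E by apply: erestrict_ge0 => y /AB; exact: f0.
apply: ge0_ae_le_integral_nomeas => //; apply: aeW => x _.
rewrite [leLHS]patchE; case: ifPn => // /set_mem Ax.
by rewrite patchE mem_set//; exact: AB.
Qed.

(** Otherwise the null set of exceptions would contain []T, T + 1[], of measure one. *)
Lemma ae_gt0_exists_gt (R : realType) (Q : R -> Prop) (T : R) : 0 <= T ->
  {ae @lebesgue_measure R, forall t, 0 < t -> Q t} -> exists2 t, T < t & Q t.
Proof.
move=> T0 [N [mN N0 QN]]; apply: contrapT => H.
have : (@lebesgue_measure R `]T, (T + 1)%R[%classic <= lebesgue_measure N)%E.
  apply: le_measure; rewrite ?inE//= => t; rewrite /= in_itv/= => /andP[Tt _].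
  apply: QN => /= Qt; apply: H; exists t => //.
  by apply: Qt; apply: le_lt_trans Tt.
rewrite lebesgue_measure_itv/= lte_fin ltrDl ltr01 -EFinD N0 addrAC subrr add0r.
by rewrite lee_fin leNgt ltr01.
Qed.

Section squared_norm.
Context (R : realType).

Lemma sqnE n (v : 'cV[R]_n) : sqn v = \sum_j v j 0 ^+ 2.
Proof.
by rewrite /sqn /dot mxE; apply: eq_bigr => j _; rewrite mxE -expr2.
Qed.

Lemma sqn_ge0 n (v : 'cV[R]_n) : 0 <= sqn v.
Proof. by rewrite sqnE sumr_ge0// => j _; rewrite sqr_ge0. Qed.

Lemma measurable_sqn d (T : measurableType d) n (f : T -> 'cV[R]_n) :
  measurable_fun setT f -> measurable_fun setT (fun x => sqn (f x)).
Proof.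
move=> mf; under eq_fun do rewrite sqnE.
apply: measurable_sum => j; apply: measurable_funX.
exact: (measurableT_comp (measurable_mx_entry j 0)).
Qed.

Lemma sqn_force n (gm gt : 'cV[R]_n) (m : R) :
  sqn (force gm gt m) = sqn gm + sqn gt + m ^+ 2.
Proof.
rewrite /sqn /dot /force !tr_col_mx !mul_row_col !mxE big_ord1 !mxE eqxx !mulr1n.
rewrite -expr2; congr (_ + _ + _).
by apply: eq_bigr => j _; rewrite !mxE mulrNN.
Qed.

End squared_norm.

(** * Coercivity integrated over the torus *)

Section integrated_coercivity.
Context (R : realType) (d : nat) (p : potential R).
Hypothesis hp : admissible_potential d p.
Notation P := (torus_measure R d).
Context (u v th : 'rV[R]_d -> R).
Hypotheses (mu_ : measurable_fun setT u) (mv : measurable_fun setT v)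
  (mth : measurable_fun setT th).
Hypotheses (th1 : (normL1 th < +oo)%E)
  (thq : (normL1 (fun x => th x `^ (- q p))%R < +oo)%E).
Let e x := e_int p (u x) (v x) (th x).
Let s x := s_bulk p (u x) (v x) (th x).
Hypothesis ie : P.-integrable setT (EFin \o e).

Lemma integrable_s_bulk : P.-integrable setT (EFin \o s).
Proof.
have [C C0 sC] := norm_s_bulk_le hp.
have mthq : measurable_fun setT (fun x => th x `^ (- q p)).
  exact: (measurableT_comp (measurable_powR _)).
have i1 : P.-integrable setT (EFin \o th).
  by apply/integrableP; split => //; exact/measurable_EFinP.
have i2 : P.-integrable setT (EFin \o (fun x => th x `^ (- q p))).
  by apply/integrableP; split => //; exact/measurable_EFinP.
have i0 : P.-integrable setT (EFin \o (fun _ : 'rV[R]_d => 1 : R)).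
  exact: finite_measure_integrable_cst.
pose h x := C * (1 + `|th x| + th x `^ (- q p) + `|e x|).
have ih : P.-integrable setT (EFin \o h).
  apply: (@eq_integrable _ _ _ _ _ measurableT (fun x => C%:E *
    (1%:E + `|(th x)%:E| + (th x `^ (- q p))%:E + `|(e x)%:E|))%E).
    by move=> x _; rewrite /h /=.
  apply: integrableZl => //; apply: integrableD => //; last exact: integrable_abse ie.
  by apply: integrableD => //; apply: integrableD => //; exact: integrable_abse i1.
apply: (le_integrable measurableT _ _ ih).
  by apply/measurable_EFinP; exact: (measurable_s_bulk hp).
move=> x _; rewrite /= lee_fin (le_trans (sC _ _ _))// /h ler_norm//.
Qed.

(** Each integrand is one of three non-negative terms of the coercive sum, so all three share the
    bound [K], the integral of [g]; the constant [C] integrates to itself because the torus has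
    measure one. *)
Lemma integral_coercive (a k C : R) : 0 < k ->
  (forall r h t, 0 < t -> k * (abs2 r h ^+ 4 + t + t `^ (- q p)) <=
    a * e_int p r h t - s_bulk p r h t + C) ->
  {ae P, forall x, 0 < th x} ->
  let K := (k^-1 * (a * \int[P]_x e x - \int[P]_x s x + C))%:E in
  [/\ (\int[P]_x (abs2 (u x) (v x) ^+ 4)%:E <= K)%E, (normL1 th <= K)%E &
      (normL1 (fun x => th x `^ (- q p))%R <= K)%E].
Proof.
move=> k0 coer th0 K; have is_ := integrable_s_bulk.
pose g x := k^-1 * (a * e x - s x + C).
have ig : P.-integrable setT (EFin \o g).
  apply: (@eq_integrable _ _ _ _ _ measurableT (fun x => k^-1%:E *
    (a%:E * (e x)%:E - (s x)%:E + C%:E))%E).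
    by [].
  apply: integrableZl => //; apply: integrableD => //; last first.
    exact: (finite_measure_integrable_cst _ C).
  by apply: integrableB => //; exact: integrableZl.
have gE : (\int[P]_x (g x)%:E = K)%E.
  rewrite [LHS](_ : _ =
    \int[P]_x (k^-1%:E * (a%:E * (e x)%:E - (s x)%:E + C%:E)))%E//.
  rewrite integralZl//; last first.
    apply: integrableD => //; last exact: (finite_measure_integrable_cst _ C).
    by apply: integrableB => //; exact: integrableZl.
  rewrite integralD//; last 2 first.
  - by apply: integrableB => //; exact: integrableZl.
  - exact: (finite_measure_integrable_cst _ C).
  rewrite integralB//; last exact: integrableZl.
  rewrite integralZl// integral_cst//.
  rewrite [X in (C%:E * X)%E](_ : _ = 1%E) ?mule1; last exact: probability_setT.
  by rewrite /K EFinM EFinD EFinB EFinM /Rintegral !fineK//;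
    exact: integrable_fin_num.
have main (f : 'rV[R]_d -> R) : (forall x, 0 <= f x) ->
    (forall x, 0 < th x ->
       f x <= abs2 (u x) (v x) ^+ 4 + th x + th x `^ (- q p)) ->
    (\int[P]_x (f x)%:E <= K)%E.
  move=> f0 fle; rewrite -gE; apply: ge0_le_integral_ae => [x _|].
    by rewrite lee_fin.
  move: th0; apply: filterS => x th0 _; rewrite lee_fin /g ler_pdivlMl//.
  by apply: le_trans (coer _ _ _ th0); rewrite ler_wpM2l ?(ltW k0)// fle.
have z0 x : 0 <= abs2 (u x) (v x) ^+ 4 by rewrite exprn_ge0// sqrtr_ge0.
have q0 x : 0 <= th x `^ (- q p) by exact: powR_ge0.
split; apply: main => x //.
- by move=> t0; rewrite -addrA lerDl addr_ge0// ltW.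
- by move=> t0; rewrite gtr0_norm// -addrA addrCA lerDl addr_ge0.
- by move=> t0; rewrite ger0_norm// lerDr addr_ge0// ltW.
Qed.

End integrated_coercivity.

(** Inserting [Ie = E0 - l] into the entropy inequality leaves five non-negative terms whose sum is
    at most [a * E0 - S0 + C]. Each quantity is this sum's bound divided by its own coefficient, and
    the sum of all the reciprocals serves as a common factor. *)
Lemma entropy_budget (R : realType) (a k gr gh C E0 S0 Is Ie l x n1 n2 : R) :
  0 < a -> 0 < k -> 0 < gr -> 0 < gh ->
  0 <= l -> 0 <= x -> 0 <= n1 -> 0 <= n2 ->
  0 <= k^-1 * (a * Ie - Is + C) ->
  Ie + l = E0 -> S0 + x <= Is - gr / 2 * n1 - gh / 2 * n2 ->
  let K := (a * E0 - S0 + C) *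
    (k^-1 + a^-1 + (gr / 2)^-1 + (gh / 2)^-1 + 1) in
  [/\ k^-1 * (a * Ie - Is + C) <= K, l <= K, x <= K, n1 <= K & n2 <= K].
Proof.
move=> a0 k0 gr0 gh0 l0 x0 n10 n20 J0 Econs hS.
have gr2 : 0 < gr / 2 by rewrite divr_gt0.
have gh2 : 0 < gh / 2 by rewrite divr_gt0.
set W := k^-1 + _ + _ + _ + _; set K1 := a * E0 - S0 + C => /=.
have {}J0 : 0 <= a * Ie - Is + C by move: J0; rewrite pmulr_rge0 ?invr_gt0.
have n1g : 0 <= gr / 2 * n1 by rewrite mulr_ge0 ?(ltW gr2).
have n2g : 0 <= gh / 2 * n2 by rewrite mulr_ge0 ?(ltW gh2).
have al : 0 <= a * l by rewrite mulr_ge0 ?(ltW a0).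
have main : (a * Ie - Is + C) + a * l + x + gr / 2 * n1 + gh / 2 * n2 <= K1.
  by rewrite /K1 -Econs mulrDr; lra.
have [kV aV] : 0 <= k^-1 /\ 0 <= a^-1 by rewrite !invr_ge0 !ltW.
have [grV ghV] : 0 <= (gr / 2)^-1 /\ 0 <= (gh / 2)^-1 by rewrite !invr_ge0 !ltW.
have inK c y : 0 < c -> c^-1 <= W -> c * y <= K1 -> y <= K1 * W.
  move=> c0 cW yK; rewrite -(mulKf (lt0r_neq0 c0) y).
  rewrite (le_trans (ler_wpM2l _ yK)) ?invr_ge0 ?(ltW c0)//.
  by rewrite mulrC ler_wpM2l//; lra.
have [kW aW grW ghW oneW] :
    [/\ k^-1 <= W, a^-1 <= W, (gr / 2)^-1 <= W, (gh / 2)^-1 <= W & 1 <= W].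
  by rewrite /W; split; lra.
split.
- by apply: (inK k) => //; rewrite (mulVKf (lt0r_neq0 k0)); lra.
- by apply: (inK a) => //; lra.
- by apply: (inK 1) => //; rewrite ?invr1//; lra.
- by apply: (inK (gr / 2)) => //; lra.
- by apply: (inK (gh / 2)) => //; lra.
Qed.

(** * Bounds uniform in time *)

Section uniform_bound.
Context (R : realType) (d : nat) (p : potential R).
Hypothesis hp : admissible_potential d p.
Context (L : mobility R d) (hL : admissible_mobility L).
Context (i : initial_data R d) (w : sextuple R d).
Hypothesis hw : is_global_solution p L w i.

Notation mu := (@lebesgue_measure R).
Notation P := (torus_measure R d).

Lemma normL2v_sq_ge0 (g : 'rV[R]_d -> 'cV[R]_d) : (0 <= normL2v_sq g)%E.
Proof. by apply: integral_ge0 => x _; rewrite lee_fin sqn_ge0. Qed.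

Lemma normL2v_sq_fin_num (u : 'rV[R]_d -> R) g : inH1 u g ->
  normL2v_sq g \is a fin_num.
Proof.
move=> [_ _ fin _]; rewrite ge0_fin_numE ?normL2v_sq_ge0//.
apply: le_lt_trans fin; apply: ge0_le_integral_ae => [x _|].
  by rewrite lee_fin sqn_ge0.
by apply: aeW => x _; rewrite lee_fin lerDr sqr_ge0.
Qed.

Lemma ZLZ_ge (lam0 : R) : (forall r h th (zeta : 'cV[R]_(d + d + 1)), 0 < th ->
    lam0 * sqn zeta <= dot zeta (L r h th *m zeta)) ->
  forall t x, 0 < theta w t x ->
  lam0 * (sqn (Dmu_rho w t x) + sqn (Dtheta w t x) + mu_eta w t x ^+ 2)
    <= ZLZ L w t x.
Proof.
move=> Llb t x th0; rewrite -sqn_force /ZLZ /dissip /mob /on_pos th0.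
exact: Llb.
Qed.

(** This holds at every point: where the temperature is not positive, [mob] is the zero matrix. The
    comparisons of integrals above ask for a sign everywhere. *)
Lemma ZLZ_ge0 t x : 0 <= ZLZ L w t x.
Proof.
case: hL => _ _ _ [lam0 [lam1 [l0 _ Lb]]].
have [th0|th0] := ltP 0 (theta w t x).
  apply: le_trans (ZLZ_ge _ th0); first last.
    by move=> r h th zeta /(Lb r h th zeta)/andP[+ _]; exact.
  by rewrite mulr_ge0 ?(ltW l0)// !addr_ge0 ?sqn_ge0 ?sqr_ge0.
by rewrite /ZLZ /dissip /mob /on_pos ltNge th0/= mul0mx /dot mulmx0 mxE.
Qed.

Lemma uniform_bound : exists K : R, {ae mu, forall t, 0 < t ->
  [/\ (\int[P]_x (abs2 (rho w t x) (eta w t x) ^+ 4)%:E <= K%:E)%E,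
      (normL1 (theta w t) <= K%:E)%E,
      (normL1 (fun x => theta w t x `^ (- q p))%R <= K%:E)%E &
      (radon_norm (lam w t) <= K%:E)%E] /\
  [/\ (normL2v_sq (Drho w t) <= K%:E)%E, (normL2v_sq (Deta w t) <= K%:E)%E &
      (time_int t (fun s => \int[P]_x (ZLZ L w s x)%:E) <= K%:E)%E]}.
Proof.
case: (hp) => _ [_ _ gr0 gh0] _ _ _.
have [a [k [C [a0 k0 coer]]]] := energy_entropy_coercive hp.
have [S0 S0E] : exists S0 : R, initial_entropy p i = S0%:E.
  case: (hw) => -[hr he _ _ is0] _ _.
  have r1 := normL2v_sq_fin_num hr; have r2 := normL2v_sq_fin_num he.
  have s1 := integrable_fin_num measurableT is0.
  eexists; rewrite /initial_entropy /entropy -(fineK r1) -(fineK r2) -(fineK s1).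
  by rewrite -!EFinM -!EFinB.
set gr := gam_rho p in gr0; set gh := gam_eta p in gh0.
(* The constant of [entropy_budget], with the initial energy and entropy: nothing in it depends on
   [t]. *)
exists ((a * \int[P]_x e0 p i x - S0 + C) *
  (k^-1 + a^-1 + (gr / 2)^-1 + (gh / 2)^-1 + 1)).
move: (energy_conserved hp hw) (regular_slices hw); apply: filterS2.
move=> t hE hR t0; have [ie Econs] := hE t0.
have [[hr he ht hm mme] [ht1 hq1 tpos l0]] := hR t0.
have [mr _ _ _] := hr; have [me _ _ _] := he; have [mt _ _ _] := ht.
have is_ := integrable_s_bulk hp mr me mt ht1 hq1 ie.
have [J1 J2 J3] := integral_coercive hp mr me mt ht1 hq1 ie k0 coer tpos.
rewrite S0E /entropy.
set X := time_int _ _.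
have X0 : (0 <= X)%E.
  by apply: integral_ge0 => s _; apply: integral_ge0 => x _; rewrite lee_fin ZLZ_ge0.
have n1f := normL2v_sq_fin_num hr; have n2f := normL2v_sq_fin_num he.
have n10 := normL2v_sq_ge0 (Drho w t); have n20 := normL2v_sq_ge0 (Deta w t).
rewrite -(fineK n1f) -(fineK n2f) !lee_fin in n10 n20 *.
set n1 := fine (normL2v_sq (Drho w t)) in n10 *.
set n2 := fine (normL2v_sq (Deta w t)) in n20 *.
have isE : (\int[P]_x (s_bulk p (rho w t x) (eta w t x) (theta w t x))%:E =
    (\int[P]_x s_bulk p (rho w t x) (eta w t x) (theta w t x))%:E)%E.
  by rewrite /Rintegral fineK//; exact: integrable_fin_num.
rewrite isE; set Is := \int[P]_x s_bulk _ _ _ _ in J1 J2 J3 *.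
set Ie := \int[P]_x e_sol p w t x in Econs *.
have {}l0n : 0 <= lam w t (fun _ => 1) by apply: l0 => //; exact: cont_per_cst.
have nl := radon_norm_le l0.
set l := lam w t (fun _ => 1) in Econs l0n nl.
rewrite -!EFinM -!EFinB.
(* An infinite dissipation would contradict the entropy inequality, whose right-hand side is
   real. *)
move: X0; case: X => [x||]//; rewrite ?lee_fin => x0 hS.
have {}hS : S0 + x <= Is - gr / 2 * n1 - gh / 2 * n2 by rewrite -lee_fin.
have J0 : 0 <= k^-1 * (a * Ie - Is + C).
  by rewrite -lee_fin; apply: le_trans J2; exact: integral_ge0.
have [Jk lK xK n1K n2K] :=
  entropy_budget a0 k0 gr0 gh0 l0n x0 n10 n20 J0 Econs hS.
split; split; rewrite ?lee_fin//.
- by rewrite (le_trans J1)// lee_fin.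
- by rewrite (le_trans J2)// lee_fin.
- by rewrite (le_trans J3)// lee_fin.
- by rewrite (le_trans nl)// lee_fin.
Qed.

End uniform_bound.

(** * From the quartic and gradient bounds to the [H^1] norm *)

Lemma abs2X4 (R : realType) (r h : R) : abs2 r h ^+ 4 = (r ^+ 2 + h ^+ 2) ^+ 2.
Proof. by rewrite (exprM _ 2 2) sqr_sqrtr// addr_ge0 ?sqr_ge0. Qed.

(** Expanding [(r^2 + h^2 - 1)^2 >= 0] gives [2 * (r^2 + h^2) <= 1 + |z|^4]. *)
Lemma sqr_le_1Dabs2X4 (R : realType) (r h : R) :
  r ^+ 2 <= 1 + abs2 r h ^+ 4 /\ h ^+ 2 <= 1 + abs2 r h ^+ 4.
Proof.
have := sqr_ge0 r; have := sqr_ge0 h; rewrite abs2X4.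
set x := r ^+ 2; set y := h ^+ 2 => y0 x0.
have : 0 <= (x + y - 1) ^+ 2 by exact: sqr_ge0.
have -> : (x + y - 1) ^+ 2 = (x + y) ^+ 2 - (x + y) *+ 2 + 1 by ring.
rewrite mulr2n => H; have := sqr_ge0 (x + y).
by split; lra.
Qed.

(** Used with [f = |z|^4]: the [1] is the measure of the torus, one [K] bounds the integral of [f]
    and the other the gradient. *)
Lemma normH1_sq_le (R : realType) d (u : 'rV[R]_d -> R) g (f : 'rV[R]_d -> R)
    (K : R) : inH1 u g -> measurable_fun setT f -> (forall x, 0 <= f x) ->
  (forall x, u x ^+ 2 <= 1 + f x) ->
  (\int[torus_measure R d]_x (f x)%:E <= K%:E)%E -> (normL2v_sq g <= K%:E)%E ->
  (normH1_sq u g <= (1 + K + K)%:E)%E.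
Proof.
move=> [mu_ mg _ _] mf f0 uf fK gK.
have msg := measurable_sqn mg.
rewrite /normH1_sq; under eq_integral do rewrite EFinD.
rewrite ge0_integralD//; last 4 first.
- by move=> x _; rewrite lee_fin sqr_ge0.
- by apply/measurable_EFinP; exact: measurable_funX.
- by move=> x _; rewrite lee_fin sqn_ge0.
- exact/measurable_EFinP.
rewrite EFinD; apply: leeD => //.
apply: (@le_trans _ _ (\int[torus_measure R d]_x (1 + (f x)%:E))%E).
  apply: ge0_le_integral_ae => [x _|]; first by rewrite lee_fin sqr_ge0.
  by apply: aeW => x _; rewrite lee_fin.
rewrite ge0_integralD//; last 2 first.
- by move=> x _; rewrite lee_fin.
- exact/measurable_EFinP.
rewrite EFinD; apply: leeD => //.
rewrite integral_cst// mul1e [leLHS](_ : _ = 1%E)//.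
exact: probability_setT.
Qed.

(** * Total dissipation, bound at almost every time, and integrability of the forces *)

Theorem lemma4p10 (R : realType) (d : nat) (hd : (1 <= d <= 3)%N)
    (p : potential R) (hp : admissible_potential d p)
    (L : mobility R d) (hL : admissible_mobility L)
    (i : initial_data R d) (w : sextuple R d)
    (hw : is_global_solution p L w i) :
  [/\ (\int[@lebesgue_measure R]_(t in `]0%R, +oo[)
         \int[torus_measure R d]_x (ZLZ L w t x)%:E < +oo)%E,
      exists C : R, {ae @lebesgue_measure R, forall t, 0 < t ->
        (normH1_sq (rho w t) (Drho w t) + normH1_sq (eta w t) (Deta w t)
         + \int[torus_measure R d]_x (abs2 (rho w t x) (eta w t x) ^+ 4)%:E
         + normL1 (theta w t) + normL1 (fun x => theta w t x `^ (- q p))%R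
         + radon_norm (lam w t) <= C%:E)%E} &
      (\int[@lebesgue_measure R]_(t in `]0%R, +oo[)
         (normL2v_sq (Dmu_rho w t) + normL2v_sq (Dtheta w t)
          + normL2_sq (mu_eta w t)) < +oo)%E].
Proof.
have [K HK] := uniform_bound hp hL hw.
have ZLZ0 t x : 0 <= ZLZ L w t x by exact: ZLZ_ge0.
have IZLZ0 t : (0 <= \int[torus_measure R d]_x (ZLZ L w t x)%:E)%E.
  by apply: integral_ge0 => x _; rewrite lee_fin.
have ZK : (\int[@lebesgue_measure R]_(t in `]0%R, +oo[)
    \int[torus_measure R d]_x (ZLZ L w t x)%:E <= K%:E)%E.
  apply: ge0_integral_itv0y_le => // n.
  (* The time [n] itself may be exceptional, so the dissipation up to [n] is bounded by that up to a
     later good time [t]. *)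
  have [t nt Ht] := ae_gt0_exists_gt (ler0n _ n) HK.
  case: Ht => _ [_ _]; apply: le_trans.
  apply: ge0_subset_integral_nomeas => // s /=.
  by rewrite !in_itv/= => /andP[-> sn]/=; exact: lt_trans nt.
split.
- exact: le_lt_trans ZK (ltry _).
- exists ((1 + K + K) + (1 + K + K) + K + K + K + K).
  move: HK (regular_slices hw); apply: filterS2 => t HK hR t0.
  have [[J1 J2 J3 J4] [n1 n2 _]] := HK t0.
  have [[hr he _ _ _] _] := hR t0.
  have [mr _ _ _] := hr; have [me _ _ _] := he.
  have mz : measurable_fun setT (fun x => abs2 (rho w t x) (eta w t x) ^+ 4).
    under eq_fun do rewrite abs2X4.
    by apply: measurable_funX; apply: measurable_funD; exact: measurable_funX.
  have z0 x : 0 <= abs2 (rho w t x) (eta w t x) ^+ 4.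
    by rewrite exprn_ge0// sqrtr_ge0.
  do 5! [rewrite EFinD; apply: leeD => //].
    apply: (normH1_sq_le hr mz) => // x.
    by case: (sqr_le_1Dabs2X4 (rho w t x) (eta w t x)).
  apply: (normH1_sq_le he mz) => // x.
  by case: (sqr_le_1Dabs2X4 (rho w t x) (eta w t x)).
- case: (hL) => _ _ _ [lam0 [lam1 [l0 _ Lb]]].
  (* Ellipticity bounds the squared forces by [lam0^-1] times the dissipation density. This factor
     is pulled out of the space integral and then, without measurability in time, out of the time
     integral. *)
  have lV : 0 < lam0^-1 by rewrite invr_gt0.
  apply: (@le_lt_trans _ _ (lam0^-1%:E * K%:E)%E); last by rewrite -EFinM ltry.
  apply: (@le_trans _ _ (lam0^-1%:E * \int[@lebesgue_measure R]_(t in `]0%R, +oo[)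
    \int[torus_measure R d]_x (ZLZ L w t x)%:E)%E); last by rewrite lee_pmul2l.
  apply: le_trans (ge0_integralZl_le _ lV _); last by [].
  apply: ge0_le_integral_ae => [t _|].
    apply: adde_ge0; first by apply: adde_ge0; exact: normL2v_sq_ge0.
    by apply: integral_ge0 => x _; rewrite lee_fin sqr_ge0.
  move: (regular_slices hw); apply: filterS => t hR /=; rewrite in_itv/=.
  move=> /andP[/hR[[_ _ [_ mt _ _] [_ mm _ _] me] [_ _ tpos _ _]] _].
  have mtq := measurable_sqn mt; have mmq := measurable_sqn mm.
  (* The three norms are merged into one space integral, where the pointwise bound applies. *)
  rewrite /normL2v_sq /normL2_sq -ge0_integralD//; last 4 first.
  + by move=> x _; rewrite lee_fin sqn_ge0.
  + exact/measurable_EFinP.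
  + by move=> x _; rewrite lee_fin sqn_ge0.
  + exact/measurable_EFinP.
  rewrite -ge0_integralD//; last 4 first.
  + by move=> x _; rewrite -EFinD lee_fin addr_ge0 ?sqn_ge0.
  + by apply: emeasurable_funD; exact/measurable_EFinP.
  + by move=> x _; rewrite lee_fin sqr_ge0.
  + by apply/measurable_EFinP; exact: measurable_funX.
  apply: le_trans (ge0_integralZl_le _ lV _); last first.
    by move=> x _; rewrite lee_fin.
  apply: ge0_le_integral_ae => [x _|].
    by rewrite -!EFinD lee_fin !addr_ge0 ?sqn_ge0 ?sqr_ge0.
  move: tpos; apply: filterS => x th0 _; rewrite -!EFinD -EFinM lee_fin.
  rewrite ler_pdivlMl//; apply: ZLZ_ge th0.
  by move=> r h th zeta /(Lb r h th zeta)/andP[+ _]; exact.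
Qed.
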